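(* Let $P$ be a nonempty set, $X$ and $Y$ Banach spaces, $F:P\times X\rightrightarrows Y$ a set-valued mapping such that $\operatorname{gph}F_p$ is closed for all $p\in P$, $\bar x\in X$, $\bar y\in Y$, $\alpha>0$, $\delta\in]0,+\infty]$ and $\mu\in]0,+\infty]$. For $p\in P$, let $\psi_p(u,v):=\|v-\bar y\|+i_{\operatorname{gph}F_p}(u,v)$, $(u,v)\in X\times Y$. Let $\partial:=\partial^C$ (Clarke subdifferential). If there is a $\gamma>0$ such that $$d_\gamma\left(0,\partial\psi_p(x,y)\right)\ge\alpha$$ for all $p\in P$, $x\in B_{\delta+\mu}(\bar x)$ and $y\in Y$ satisfying $x\notin F_p^{-1}(\bar y)$ and $y\in F(p,x)\cap B_{\alpha\mu}(\bar y)$, then $F$ is $\alpha$-subregular in $x$ uniformly in $p$ over $P$ at $(\bar x,\bar y)$ with $\delta$ and $\mu$. If $X$ and $Y$ are Asplund, then the same implication is valid with $\partial:=\partial^F$ (Fréchet subdifferential), i.e. if there is a $\gamma>0$ such that $$d_\gamma\left(0,\partial^F\psi_p(x,y)\right)\ge\alpha$$ for all $p\in P$, $x\in B_{\delta+\mu}(\bar x)$ and $y\in Y$ satisfying $x\notin F_p^{-1}(\bar y)$ and $y\in F(p,x)\cap B_{\alpha\mu}(\bar y)$, then $F$ is $\alpha$-subregular in $x$ uniformly in $p$ over $P$ at $(\bar x,\bar y)$ with $\delta$ and $\mu$.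
   Context: $B_r(z)$ denotes the open ball with center $z$ and radius $r\in]0,+\infty]$. $d(z,\emptyset)=+\infty$. $i_\Omega$ is the indicator function ($0$ on $\Omega$, $+\infty$ elsewhere). For $p\in P$, $F_p:=F(p,\cdot)$, $\operatorname{gph}F_p=\{(x,y)\mid y\in F(p,x)\}$, $F_p^{-1}(y)=\{x\in X\mid y\in F(p,x)\}$. Definition. $F$ is $\alpha$-subregular in $x$ uniformly in $p$ over $P$ at $(\bar x,\bar y)$ with $\delta$ and $\mu$ if $\alpha\, d(x,F_p^{-1}(\bar y))\le d(\bar y,F(p,x))$ for all $p\in P$ and $x\in B_\delta(\bar x)$ with $d(\bar y,F(p,x))<\alpha\mu$. For $\gamma>0$, $d_\gamma$ on $X^*\times Y^*$ is the distance induced by the norm $\|(x^*,y^* )\|_\gamma=\|x^*\|+\gamma^{-1}\|y^*\|$ (dual to the norm $\max\{\|x\|,\gamma\|y\|\}$ on $X\times Y$). Fréchet subdifferential of $f:Z\to\mathbb R\cup\{+\infty\}$ at $\bar z\in\operatorname{dom}f$: $\partial^Ff(\bar z)=\{z^*\in Z^*\mid \liminf_{z\to\bar z,\,z\ne\bar z}\frac{f(z)-f(\bar z)-\langle z^*,z-\bar z\rangle}{\|z-\bar z\|}\ge0\}$. Clarke tangent cone $T^C_\Omega(\bar z)$ to $\Omega$ at $\bar z\in\Omega$: the set of $w$ such that for all sequences $z_k\to\bar z$ in $\Omega$ and $t_k\downarrow0$ there exist $w_k\to w$ with $z_k+t_kw_k\in\Omega$ for all $k$. Clarke normal cone: $N^C_\Omega(\bar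 z)=\{z^*\mid\langle z^*,w\rangle\le0\ \forall w\in T^C_\Omega(\bar z)\}$. Clarke(–Rockafellar) subdifferential: $\partial^Cf(\bar z)=\{z^*\mid (z^*,-1)\in N^C_{\operatorname{epi}f}(\bar z,f(\bar z))\}$. A Banach space is Asplund if the dual of each of its separable subspaces is separable. *)

(* Defs.v *)
From HB Require Import structures.
From mathcomp Require Import all_boot all_order all_algebra.
From mathcomp Require Import all_classical all_reals all_analysis.
Set Implicit Arguments.
Unset Strict Implicit.
Unset Printing Implicit Defensive.
Import Order.TTheory GRing.Theory Num.Theory.
Import numFieldNormedType.Exports.
Local Open Scope classical_set_scope.
Local Open Scope ring_scope.

Section dual.
Context {R : realType} (V : normedModType R).

Definition continuous_linear : {pred V -> R} :=
  mem [set f : V -> R | linear f /\ continuous f].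

Record dual := Dual {
  dual_fun :> V -> R ;
  dualP : dual_fun \in continuous_linear }.

HB.instance Definition _ := [isSub for dual_fun].
HB.instance Definition _ := [Choice of dual by <:].

Lemma continuous_linear_submod_closed : submod_closed continuous_linear.
Proof.
split.
  rewrite inE; split; last exact: cst_continuous.
  by move=> a x y /=; rewrite scaler0 addr0.
move=> a f g /set_mem[lf cf] /set_mem[lg cg]; rewrite inE; split.
  move=> b x y /=; rewrite !fctE lf lg !scalerDr addrACA.
  by rewrite !scalerA mulrC.
move=> x; apply: cvgD; last exact: cg.
by apply: cvgZr; exact: cf.
Qed.

HB.instance Definition _ := GRing.isSubmodClosed.Build R (V -> R)
  continuous_linear continuous_linear_submod_closed.
HB.instance Definition _ := [SubChoice_isSubLmodule of dual by <:].

Lemma dual_linear (f : dual) : linear f.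
Proof. by have /set_mem[] := dualP f. Qed.

HB.instance Definition _ (f : dual) :=
  GRing.isLinear.Build R V R _ f (dual_linear f).

Lemma dual_continuous (f : dual) : continuous f.
Proof. by have /set_mem[] := dualP f. Qed.

Lemma dualD (f g : dual) x : (f + g) x = f x + g x. Proof. by []. Qed.

Lemma dualZ a (f : dual) x : (a *: f) x = a * f x. Proof. by []. Qed.

Definition dual_norm (f : dual) : R :=
  sup [set `|f x| | x in [set x : V | `|x| <= 1]].

Lemma dual_norm_has_sup (f : dual) :
  has_sup [set `|f x| | x in [set x : V | `|x| <= 1]].
Proof.
split; first by exists `|f 0|; exists 0 => //=; rewrite normr0.
have /linear_bounded_continuous/bounded_funP/(_ 1)[M fM] : continuous (f : {linear V -> R}).
  exact: dual_continuous.
by exists M => _ [x /= x1 <-]; exact: fM.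
Qed.

Lemma dual_norm_ub (f : dual) x : `|x| <= 1 -> `|f x| <= dual_norm f.
Proof.
by move=> x1; apply: sup_upper_bound; [exact: dual_norm_has_sup|exists x].
Qed.

Lemma dual_norm_le (f : dual) M :
  (forall x, `|x| <= 1 -> `|f x| <= M) -> dual_norm f <= M.
Proof.
move=> fM; apply: ge_sup; first by case: (dual_norm_has_sup f).
by move=> _ [x /= x1 <-]; exact: fM.
Qed.

Lemma dual_normD (f g : dual) : dual_norm (f + g) <= dual_norm f + dual_norm g.
Proof.
apply: dual_norm_le => x x1; rewrite dualD (le_trans (ler_normD _ _))//.
by rewrite lerD ?dual_norm_ub.
Qed.

Lemma dual_normZ (a : R) (f : dual) : dual_norm (a *: f) = `|a| * dual_norm f.
Proof.
have leZ b g : dual_norm (b *: g) <= `|b| * dual_norm g.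
  apply: dual_norm_le => x x1; rewrite dualZ normrM.
  by rewrite ler_wpM2l// dual_norm_ub.
apply/eqP; rewrite eq_le leZ/=.
have [->|a0] := eqVneq a 0.
  rewrite normr0 mul0r (le_trans (normr_ge0 ((0 *: f) 0)))//.
  by rewrite dual_norm_ub// normr0.
rewrite -ler_pdivlMl ?normr_gt0// -normfV.
by rewrite -[f in leLHS](scalerK a0) leZ.
Qed.

Lemma dual_norm_eq0 (f : dual) : dual_norm f = 0 -> f = 0.
Proof.
move=> f0; apply/val_inj/funext => x /=.
have [->|x0] := eqVneq x 0; first by rewrite linear0.
have nx0 : `|x| != 0 by rewrite normr_eq0.
have : `|f (`|x|^-1 *: x)| <= 0.
  by rewrite -f0 dual_norm_ub// normrZ normfV normr_id mulVf.
rewrite normr_le0 linearZ/= scaler_eq0 invr_eq0 (negbTE nx0)/=.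
by move/eqP.
Qed.

HB.instance Definition _ :=
  Lmodule_isNormed.Build R dual dual_normD dual_normZ dual_norm_eq0.

End dual.

Section dual_prod.
Context {R : realType} (U V : normedModType R).

Lemma dual_pair_subproof (f : dual U) (g : dual V) :
  (fun w : U * V => f w.1 + g w.2) \in @continuous_linear R (U * V)%type.
Proof.
rewrite inE; split.
  by move=> a x y /=; rewrite !linearP scalerDr addrACA.
move=> w; apply: cvgD.
  by apply: (@cvg_comp _ _ _ fst f); [exact: cvg_fst|exact: dual_continuous].
by apply: (@cvg_comp _ _ _ snd g); [exact: cvg_snd|exact: dual_continuous].
Qed.

(* the pair (f, g) seen as the functional (u, v) |-> f u + g v *)
Definition dual_pair (f : dual U) (g : dual V) : dual (U * V)%type :=
  Dual (dual_pair_subproof f g).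

End dual_prod.

Section dual_scalar.
Context {R : realType}.

Lemma dual_scalar_subproof (a : R) : *%R a \in @continuous_linear R R.
Proof.
rewrite inE; split; last exact: mulrl_continuous.
by move=> b x y; rewrite mulrDr -mulr_algl scaler1 mulrCA.
Qed.

(* the real a seen as the functional t |-> a * t *)
Definition dual_scalar (a : R) : dual R := Dual (dual_scalar_subproof a).

End dual_scalar.

Section subspace.
Context {R : realType} (V : normedModType R) (M : submodClosed V).

Record lin_subspace := LinSubspace {
  lin_subspace_val :> V ;
  lin_subspaceP : lin_subspace_val \in M }.

HB.instance Definition _ := [isSub for lin_subspace_val].
HB.instance Definition _ := [Choice of lin_subspace by <:].
HB.instance Definition _ := [SubChoice_isSubLmodule of lin_subspace by <:].

Let nrm (x : lin_subspace) : R := `|val x|.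

Let nrmD x y : nrm (x + y) <= nrm x + nrm y.
Proof. exact: ler_normD. Qed.

Let nrmZ (a : R) x : nrm (a *: x) = `|a| * nrm x.
Proof. exact: normrZ. Qed.

Let nrm_eq0 x : nrm x = 0 -> x = 0.
Proof. by move=> /normr0_eq0 x0; exact: val_inj. Qed.

HB.instance Definition _ :=
  Lmodule_isNormed.Build R lin_subspace nrmD nrmZ nrm_eq0.

End subspace.

Definition separable (T : topologicalType) :=
  exists2 D : set T, countable D & dense D.

Definition asplund {R : realType} (V : normedModType R) :=
  forall M : submodClosed V,
    separable (lin_subspace M) -> separable (dual (lin_subspace M)).

Section subdifferentials.
Context {R : realType} (Z : normedModType R).
Implicit Types (f : Z -> \bar R) (z : Z).
Local Open Scope ereal_scope.

(* [f z \is a fin_num] says that z belongs to dom f. *)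
Definition frechet_subdiff f z : set (dual Z) :=
  [set zs | f z \is a fin_num /\
    0 <= limf_einf
      (fun w => (f w - f z - (zs (w - z)%R)%:E) * (`|w - z|^-1)%R%:E) z^'].

(* t_k decreasing to 0 is read as: t_k > 0 and t_k tends to 0. *)
Definition clarke_tangent (A : set Z) z : set Z :=
  [set w | forall (z_ : nat -> Z) (t_ : nat -> R),
    (forall k, A (z_ k)) -> z_ @ \oo --> z ->
    (forall k, 0 < t_ k)%R -> t_ @ \oo --> 0%R ->
    exists2 w_ : nat -> Z, w_ @ \oo --> w &
      forall k, A (z_ k + t_ k *: w_ k)%R].

Definition clarke_normal (A : set Z) z : set (dual Z) :=
  [set zs | forall w, clarke_tangent A z w -> (zs w <= 0)%R].

Definition epigraph f : set (Z * R) := [set zt | f zt.1 <= zt.2%:E].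

End subdifferentials.

Definition clarke_subdiff {R : realType} (Z : normedModType R)
    (f : Z -> \bar R) (z : Z) : set (dual Z) :=
  [set zs | f z \is a fin_num /\
    clarke_normal (epigraph f) (z, fine (f z))
      (dual_pair zs (dual_scalar (- 1)))].

Section subregularity.
Context {R : realType} (X Y : normedModType R).
Local Open Scope ereal_scope.

Definition eball (Z : normedModType R) (z : Z) (r : \bar R) : set Z :=
  [set w | `|w - z|%:E < r].

Definition gph (G : X -> set Y) : set (X * Y) := [set w | G w.1 w.2].

Definition invmap (G : X -> set Y) (y : Y) : set X := [set x | G x y].

(* [edist_inf A z] is d(z, A), with value +oo when A is empty *)
Definition subregular (P : Type) (F : P -> X -> set Y) (xbar : X) (ybar : Y)
    (alpha : R) (delta mu : \bar R) :=
  forall p x, eball xbar delta x ->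
    edist_inf (F p x) ybar < alpha%:E * mu ->
    alpha%:E * edist_inf (invmap (F p) ybar) x <= edist_inf (F p x) ybar.

Definition indicator (Z : Type) (A : set Z) (z : Z) : \bar R :=
  if z \in A then 0 else +oo.

Definition psi (G : X -> set Y) (ybar : Y) (w : X * Y) : \bar R :=
  `|w.2 - ybar|%:E + indicator (gph G) w.

Definition dist_gamma (gamma : R) (xys xys' : dual X * dual Y) : R :=
  (`|xys.1 - xys'.1| + gamma^-1 * `|xys.2 - xys'.2|)%R.

(* [dual_pair] identifies X^* * Y^* with (X * Y)^*, where subdifferentials of
   functions on X * Y live. *)
Definition dist_gamma_set (gamma : R) (xys : dual X * dual Y)
    (A : set (dual (X * Y)%type)) : \bar R :=
  ereal_inf [set (dist_gamma gamma xys xys')%:E |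
             xys' in [set xys' | A (dual_pair xys'.1 xys'.2)]].

End subregularity.

(* Main.v *)
Require Import Defs.
From HB Require Import structures.
From mathcomp Require Import all_boot all_order all_algebra.
From mathcomp Require Import all_classical all_reals all_analysis.
From mathcomp Require Import ring lra.

(* If subregularity fails at [x], pick [y] in [F p x] almost realizing the distance
   to [ybar]; then [(x, y)] almost minimizes [psi_p].  A variational principle
   yields a nearby exact minimizer [z] of [psi_p] plus a perturbation whose slope
   is below [alpha], and we need a subgradient of [psi_p] of norm [< alpha] there.
   Clarke case: perturb by a norm and separate the Clarke tangent cone of the
   epigraph from the hypograph of minus that norm.
   Frechet case: a perturbation that is Frechet differentiable (from above) turns
   minimality into a Frechet subgradient at once.  On a space with separable dual
   every norm has uniform approximations of this kind, obtained by conjugating a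
   locally uniformly rotund perturbation of the indicator of the dual ball.  For a
   general Asplund space one works on a separable closed subspace, chosen so large
   that the finitary (Hahn-Banach) description of "there is a small Frechet
   subgradient" transfers from the subspace to the whole space. *)

Set Implicit Arguments.
Unset Strict Implicit.
Unset Printing Implicit Defensive.
Import Order.TTheory GRing.Theory Num.Theory.
Import numFieldNormedType.Exports.
Local Open Scope classical_set_scope.
Local Open Scope ring_scope.

(** * The Hahn-Banach theorem as a sandwich theorem *)

(** The obstacle is infinity: a smooth variational principle naturally produces an infinite sum of
    bumps and a limit of their gradients, and a separable reduction has to see functionals through
    countably many data. Everything is therefore kept at finite stages. Perturbed minimality is
    stated for partial sums with an error tending to [0], and the gradients of the partial sums stay
    a sequence. [fuzzy] tests finite lists of points, so that one late gradient serves each list,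
    and a single functional is drawn from Hahn-Banach only at the end, on the whole space. In the
    smooth approximation, too, [sandwich_dual] stands in for weak-star compactness.
    Differentiability from above suffices because minimality of [g + phi] at [z] reads
    [g u - g z >= phi z - phi u], where only an upper estimate of [phi u] is wanted. The gap between
    [sigma] and the slope [s] of the initial term pays for the bumps, whose total slope on the unit
    ball of [N] is at most [10 * c]. *)

Section hahn_banach.
Context {R : realType} {E : lmodType R}.
Implicit Types (q N : E -> R) (x y w : E).

(** Homogeneity is asked as an inequality, which is easier to check for infima; applying it to
    [t^-1] gives the reverse one, and [t = 2], [t = 2^-1] give [p 0 = 0]. *)
Definition sublinear (p : E -> R) :=
  (forall x y, p (x + y) <= p x + p y) /\
  (forall t x, 0 < t -> p (t *: x) <= t * p x).

Lemma sublinear0 p : sublinear p -> p 0 = 0.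
Proof.
move=> [_ pZ].
have h2 : p 0 <= 2 * p 0 by rewrite -{1}[0](scaler0 _ 2) pZ.
have h1 : p 0 <= 2^-1 * p 0 by rewrite -{1}[0](scaler0 _ 2^-1) pZ// invr_gt0.
lra.
Qed.

Lemma sublinearZ p t x : sublinear p -> 0 <= t -> p (t *: x) = t * p x.
Proof.
move=> sp; rewrite le_eqVlt => /predU1P[<-|t0].
  by rewrite scale0r mul0r sublinear0.
apply/eqP; rewrite eq_le sp.2//=.
have := sp.2 t^-1 (t *: x); rewrite invr_gt0 => /(_ t0).
by rewrite scalerA mulVf ?gt_eqF// scale1r ler_pdivlMl.
Qed.

Lemma sublinear_ge p x : sublinear p -> - p (- x) <= p x.
Proof.
by move=> sp; rewrite lerNl -subr_ge0 opprK addrC -(sublinear0 sp) -(subrr x) sp.1.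
Qed.

Let shift (p : E -> R) y x := inf [set p (x + t *: y) - t * p y | t in [set t | 0 <= t]].

Let shift_lb p y x : sublinear p ->
  lbound [set p (x + t *: y) - t * p y | t in [set t | 0 <= t]] (- p (- x)).
Proof.
move=> sp _ [t /= t0 <-]; rewrite lerNl opprB -(sublinearZ _ sp)// lerBlDr.
by rewrite -{1}(addKr x (t *: y)) sp.1.
Qed.

Let shift_le p y x t : sublinear p -> 0 <= t ->
  shift p y x <= p (x + t *: y) - t * p y.
Proof.
move=> sp t0; apply: ge_inf; last by exists t.
by exists (- p (- x)); exact: shift_lb.
Qed.

Let shift_lt p y x a : shift p y x < a ->
  exists2 t, 0 <= t & p (x + t *: y) - t * p y < a.
Proof.
move=> /inf_lt[|_ [t /= t0 <-] ta]; last by exists t.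
by exists (p (x + 0 *: y) - 0 * p y); exists 0 => /=.
Qed.

Let shift_sublinear p y : sublinear p -> sublinear (shift p y).
Proof.
move=> sp; split=> [x1 x2|t x t0].
  apply/ler_addgt0Pr => e e0.
  have [t1 t10 h1] : exists2 t, 0 <= t &
      p (x1 + t *: y) - t * p y < shift p y x1 + e / 2.
    by apply: shift_lt; rewrite ltrDl divr_gt0.
  have [t2 t20 h2] : exists2 t, 0 <= t &
      p (x2 + t *: y) - t * p y < shift p y x2 + e / 2.
    by apply: shift_lt; rewrite ltrDl divr_gt0.
  have := shift_le y (x1 + x2) sp (addr_ge0 t10 t20).
  have := sp.1 (x1 + t1 *: y) (x2 + t2 *: y).
  rewrite addrACA -scalerDl; lra.
apply/ler_addgt0Pr => e e0.
have [s s0 h] : exists2 s, 0 <= s &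
    p (x + s *: y) - s * p y < shift p y x + e / t.
  by apply: shift_lt; rewrite ltrDl divr_gt0.
apply: (le_trans (shift_le y (t *: x) sp (mulr_ge0 (ltW t0) s0))).
rewrite -scalerA -scalerDr (sublinearZ _ sp (ltW t0)) -mulrA -mulrBr.
by rewrite -ler_pdivlMl// mulrDr mulKf ?gt_eqF// [_^-1 * e]mulrC ltW.
Qed.

(* A minimal sublinear functional is additive: otherwise [shift p y], the
   largest sublinear functional below [p] whose value at [-y] is [-p y], would
   be strictly smaller. *)
Lemma hahn_banach q : sublinear q -> exists2 a : E -> R, linear a & forall x, a x <= q x.
Proof.
move=> sq.
pose T := {p : E -> R | `[< sublinear p /\ forall x, p x <= q x >]}.
pose below (p1 p2 : T) := `[< forall x, val p2 x <= val p1 x >].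
have q0P : `[< sublinear q /\ forall x, q x <= q x >] by apply/asboolP; split.
pose q0 : T := exist _ q q0P.
have valT (p : T) : sublinear (val p) /\ forall x, val p x <= q x.
  by have /asboolP := valP p.
have [||A totA|p pmin] := @ZL_preorder T q0 below.
- by move=> p; apply/asboolP.
- move=> p2 p1 p3 /asboolP h1 /asboolP h2; apply/asboolP => x.
  exact: (le_trans (h2 x)).
- have [[p0 Ap0]|A0] := pselect (exists p0, A p0); last first.
    by exists q0 => s As; case: A0; exists s.
  (* The pointwise infimum bounds the chain: it is finite because of [- q (- x)], and totality lets
     the smaller of two functionals serve both arguments in subadditivity. *)
  pose m x := inf [set val p x | p in A].
  have mlb x : lbound [set val p x | p in A] (- q (- x)).
    move=> _ [p Ap <-]; apply: le_trans (sublinear_ge x (valT p).1).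
    by rewrite lerN2 (valT p).2.
  have m_le x p : A p -> m x <= val p x.
    by move=> Ap; apply: ge_inf; [exists (- q (- x))|exists p].
  have m_lt x a : m x < a -> exists2 p, A p & val p x < a.
    move=> /inf_lt[|_ [p Ap <-] pa]; last by exists p.
    by exists (val p0 x); exists p0.
  have mP : `[< sublinear m /\ forall x, m x <= q x >].
    apply/asboolP; split; last first.
      by move=> x; apply: (le_trans (m_le x _ Ap0)); exact: (valT p0).2.
    split=> [x y|t x t0].
      apply/ler_addgt0Pr => e e0.
      have [p1 Ap1 h1] : exists2 p, A p & val p x < m x + e / 2.
        by apply: m_lt; rewrite ltrDl divr_gt0.
      have [p2 Ap2 h2] : exists2 p, A p & val p y < m y + e / 2.
        by apply: m_lt; rewrite ltrDl divr_gt0.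
      have [/asboolP p12|/asboolP p21] := totA _ _ Ap1 Ap2.
        have := m_le (x + y) _ Ap2; have := (valT p2).1.1 x y.
        by have := p12 x; lra.
      have := m_le (x + y) _ Ap1; have := (valT p1).1.1 x y.
      by have := p21 y; lra.
    apply/ler_addgt0Pr => e e0.
    have [p1 Ap1 h1] : exists2 p, A p & val p x < m x + e / t.
      by apply: m_lt; rewrite ltrDl divr_gt0.
    apply: (le_trans (m_le _ _ Ap1)); apply: (le_trans ((valT p1).1.2 _ _ t0)).
    by rewrite -ler_pdivlMl// mulrDr mulKf ?gt_eqF// [_^-1 * e]mulrC ltW.
  exists (exist (fun p : E -> R => `[< sublinear p /\ forall x, p x <= q x >]) m mP).
  move=> s As; by apply/asboolP => x /=; exact: m_le.
have [sp pq] := valT p; exists (val p) => // .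
have shP y : `[< sublinear (shift (val p) y) /\ forall x, shift (val p) y x <= q x >].
  apply/asboolP; split; first exact: shift_sublinear.
  move=> x; apply: le_trans (pq x).
  by have := shift_le y x sp (lexx 0); rewrite scale0r addr0 mul0r subr0.
have pD x y : val p (x + y) = val p x + val p y.
  apply/eqP; rewrite eq_le sp.1 andTb.
  pose s : T := exist (fun p : E -> R => `[< sublinear p /\ forall x, p x <= q x >])
    (shift (val p) y) (shP y).
  have hs : val p x <= shift (val p) y x.
    suff /pmin/asboolP : below p s by apply.
    apply/asboolP => /= z.
    by have := shift_le y z sp (lexx 0); rewrite scale0r addr0 mul0r subr0.
  have := shift_le y x sp ler01; rewrite scale1r mul1r; move: hs; rewrite /=; lra.
have pN x : val p (- x) = - val p x.
  by apply/eqP; rewrite -subr_eq0 opprK -pD addNr sublinear0.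
move=> t x y; rewrite pD; congr (_ + _).
have [t0|/ltW t0] := lerP 0 t; first exact: sublinearZ.
rewrite -[t]opprK scaleNr pN (sublinearZ x sp) ?oppr_ge0//.
by rewrite -mulNr.
Qed.

Definition seminorm N :=
  (forall x y, N (x + y) <= N x + N y) /\ (forall t x, N (t *: x) = `|t| * N x).

Lemma seminormN N x : seminorm N -> N (- x) = N x.
Proof. by move=> [_ NZ]; rewrite -scaleN1r NZ normrN1 mul1r. Qed.

Lemma seminorm0 N : seminorm N -> N 0 = 0.
Proof. by move=> [_ NZ]; rewrite -(scale0r 0) NZ normr0 mul0r. Qed.

Lemma seminorm_ge0 N x : seminorm N -> 0 <= N x.
Proof.
move=> sN; have := sN.1 x (- x).
by rewrite subrr seminorm0// seminormN//; lra.
Qed.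

(* Take [a] below the infimal convolution of [N] with the gauge of [T]. *)
Lemma sandwich N (T : set (E * R)) : seminorm N -> T !=set0 ->
  (forall w r w' r', T (w, r) -> T (w', r') -> T (w + w', r + r')) ->
  (forall t w r, 0 < t -> T (w, r) -> T (t *: w, t * r)) ->
  (forall w r, T (w, r) -> 0 <= r + N w) ->
  exists a : E -> R, [/\ linear a, forall x, a x <= N x &
    forall w r, T (w, r) -> a w <= r].
Proof.
move=> sN T0 TD TZ TN.
pose S h := [set wr.2 + N (h - wr.1) | wr in T].
have S0 h : S h !=set0 by case: T0 => wr Twr; exists (wr.2 + N (h - wr.1)); exists wr.
have Slb h : lbound (S h) (- N h).
  move=> _ [[w r] /TN /= Twr <-]; have := sN.1 h (w - h).
  by rewrite addrC subrK -(seminormN (w - h))// opprB; lra.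
have q_le h w r : T (w, r) -> inf (S h) <= r + N (h - w).
  by move=> Twr; apply: ge_inf; [exists (- N h)|exists (w, r)].
have q_lt h e : inf (S h) < e -> exists w r, T (w, r) /\ r + N (h - w) < e.
  by move=> /(inf_lt (S0 h))[_ [[w r] /= Twr <-] h1]; exists w, r.
have qZ0 w r h t : 0 < t -> T (w, r) -> inf (S h) <= t * r + N (h - t *: w).
  by move=> t0 Twr; apply: q_le; exact: TZ.
have sq : sublinear (fun h => inf (S h)).
  split=> [x y|t x t0]; apply/ler_addgt0Pr => e e0.
    have [w1 [r1 [T1 h1]]] : exists w r, T (w, r) /\ r + N (x - w) < inf (S x) + e / 2.
      by apply: q_lt; rewrite ltrDl divr_gt0.
    have [w2 [r2 [T2 h2]]] : exists w r, T (w, r) /\ r + N (y - w) < inf (S y) + e / 2.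
      by apply: q_lt; rewrite ltrDl divr_gt0.
    have := q_le (x + y) _ _ (TD _ _ _ _ T1 T2).
    have := sN.1 (x - w1) (y - w2); rewrite addrACA -opprD; lra.
  have [w1 [r1 [T1 h1]]] : exists w r, T (w, r) /\ r + N (x - w) < inf (S x) + e / t.
    by apply: q_lt; rewrite ltrDl divr_gt0.
  have := q_le (t *: x) _ _ (TZ _ _ _ t0 T1) => /le_trans; apply.
  rewrite -scalerBr sN.2 gtr0_norm// -mulrDr -ler_pdivlMl//.
  by rewrite mulrDr mulKf ?gt_eqF// [_^-1 * e]mulrC ltW.
have [a la aq] := hahn_banach sq.
exists a; split => // [x|w r Twr].
  apply: (le_trans (aq x)); apply/ler_addgt0Pr => e e0.
  case: T0 => -[w r] Twr.
  have [M0|M0] := lerP (r + N w) 0.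
    have := q_le x _ _ Twr; have := sN.1 x (- w); rewrite seminormN//; lra.
  (* [T] need not contain [(0, 0)]; scaling one of its elements by this [t] makes its contribution
     [t * (r + N w)] equal to [e]. *)
  have t0 : 0 < e / (r + N w) by rewrite divr_gt0.
  have := qZ0 _ _ x _ t0 Twr.
  have := sN.1 x (- (e / (r + N w) *: w)).
  rewrite seminormN// sN.2 gtr0_norm//.
  have : e / (r + N w) * (r + N w) = e by rewrite divfK// gt_eqF.
  rewrite mulrDr; lra.
apply: (le_trans (aq w)); have := q_le w _ _ Twr.
by rewrite subrr seminorm0// addr0.
Qed.

End hahn_banach.

(** * A smooth variational principle *)

Lemma half_power_lt {R : realType} (e : R) : 0 < e ->
  exists k, forall j, (k <= j)%N -> 2^-1 ^+ j < e.
Proof.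
move=> e0; have /cvgrPdist_lt/(_ _ e0) : @GRing.exp R 2^-1 @ \oo --> 0.
  by apply: cvg_expr; rewrite ger0_norm ?invr_ge0// invf_lt1// ltr1n.
case=> k _ kP; exists k => j /kP.
by rewrite sub0r normrN ger0_norm// exprn_ge0// invr_ge0.
Qed.

Section variational_principle.
Context {R : realType} {E : normedModType R}.
Implicit Types (N : E -> R) (x y z u : E).

Definition equivalent_norm N := [/\ seminorm N,
  exists2 c, 0 < c & forall x, c * `|x| <= N x &
  exists2 K, 0 < K & forall x, N x <= K * `|x| ].

(** A property rather than a structure, so that it passes to products and along isometries with
    closed range, on types that carry only a norm. *)
Definition seq_complete := forall u : nat -> E,
  (forall e, 0 < e -> exists k, forall j, (k <= j)%N -> `|u j - u k| < e) ->
  exists l : E, u @ \oo --> l.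

Lemma nonexpansive_continuous N (f : E -> R) : equivalent_norm N ->
  (forall x h, f (x + h) - f x <= N h) -> continuous f.
Proof.
move=> [sN _ [K K0 NK]] fN x.
apply/cvgrPdist_le => e e0; near=> y.
have h1 := fN x (y - x); have h2 := fN y (x - y); have hK := NK (y - x).
have hN : N (x - y) = N (y - x) by rewrite -(seminormN (y - x))// opprB.
have hy : K * `|y - x| <= e.
  rewrite -ler_pdivlMl// distrC mulrC; near: y; apply: cvgr_dist_le => //.
  by rewrite divr_gt0.
move: h1 h2; rewrite !subrKC => h1 h2.
by rewrite ler_norml; apply/andP; split; lra.
Unshelve. all: by end_near. Qed.

Lemma continuous_le_lim (f : E -> R) (x_ : nat -> E) z v k : continuous f ->
  x_ @ \oo --> z -> (forall i, (k <= i)%N -> f (x_ i) <= v) -> f z <= v.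
Proof.
move=> cf xz fv; apply: (@closed_cvg _ _ _ _ _ [set r | r <= v] _ _ _ (cvg_comp _ _ xz (cf z))).
  exact: closed_le.
by exists k => // i /= ki; exact: fv.
Qed.

Let d (k : nat) : R := 2^-1 ^+ k.

(* The perturbed functions are [g + perturbation k]; the bump centred at [x_ i]
   confines all later points to the ball of radius [2 * 2^-i] around [x_ i]. *)
Definition perturbation (phi : R -> E -> R) (s c eta : R) (z0 : E) (x_ : nat -> E) k u :=
  s * phi eta (u - z0) +
  \sum_(i < k) c * 2^-1 ^+ i * Num.max (phi (2^-1 ^+ i) (u - x_ i)) 0 ^+ 2.

(** Each [x_ k] nearly minimizes the [k]-th partial sum, and the bump at [x_ k] penalizes leaving
    it, which makes the sequence Cauchy; [z] is its limit. The bump of scale [2^-1 ^+ k] uses the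
    approximation of [N] with that same precision, so the error of [phi] never exceeds the radius to
    be controlled. *)
Theorem variational_principle N (D : set E) (g : E -> R) (phi : R -> E -> R)
    (sigma lambda rho : R) (z0 : E) :
  equivalent_norm N -> seq_complete -> closed D -> continuous g ->
  (forall u, D u -> 0 <= g u) ->
  (forall eta x, 0 < eta -> N x - eta <= phi eta x <= N x) ->
  (forall eta x h, 0 < eta -> phi eta (x + h) - phi eta x <= N h) ->
  D z0 -> 0 < sigma -> 0 < lambda -> 0 < rho -> g z0 < sigma * lambda ->
  exists s c eta z (x_ : nat -> E), [/\ [/\ 0 < s, 0 < c, 0 < eta & s + 10 * c <= sigma],
    [/\ D z, N (z - z0) < lambda & g z < g z0 + rho],
    forall k, N (z - x_ k) <= 2 * 2^-1 ^+ k &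
    forall u k, D u -> g z + perturbation phi s c eta z0 x_ k z <=
      g u + perturbation phi s c eta z0 x_ k u + c * 2^-1 ^+ k].
Proof.
move=> eN cplE cD cg g0 phiN phiL Dz0 sigma0 lambda0 rho0 gz0.
have [sN [cN cN0 NcN] [K K0 NK]] := eN.
(* Strictly between [g z0 / lambda] and [sigma]: the first gap keeps [z] within [lambda] of [z0],
   the second one finances the bumps. *)
pose s := (g z0 / lambda + sigma) / 2.
have gl : g z0 / lambda < sigma by rewrite ltr_pdivrMr.
have gl0 : 0 <= g z0 / lambda by rewrite divr_ge0 ?g0// ltW.
have s0 : 0 < s by rewrite /s; lra.
have ssigma : s < sigma by rewrite /s; lra.
have gzs : g z0 < s * lambda by rewrite -ltr_pdivrMr// /s; lra.
pose c := (sigma - s) / 10.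
have c0 : 0 < c by rewrite /c; lra.
(* Replacing [N] by [phi eta] in the initial term loses at most [s * eta], which has to fit into
   both [s * lambda - g z0] and [rho]. *)
pose eta := Num.min (lambda - g z0 / s) (rho / s) / 2.
have gs : g z0 / s < lambda by rewrite ltr_pdivrMr// mulrC.
have eta0 : 0 < eta by rewrite divr_gt0// lt_min subr_gt0 gs divr_gt0.
have eta1 : eta < lambda - g z0 / s.
  have : Num.min (lambda - g z0 / s) (rho / s) <= lambda - g z0 / s.
    by rewrite ge_min lexx.
  by move: eta0; rewrite /eta; lra.
have eta2 : s * eta < rho.
  rewrite -ltr_pdivlMl// mulrC.
  have : Num.min (lambda - g z0 / s) (rho / s) <= rho / s by rewrite ge_min lexx orbT.
  by move: eta0; rewrite /eta; lra.
have d0 k : 0 < d k by rewrite exprn_gt0// invr_gt0.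
(* A later point has bump value at most [eps k]; dividing by [c * d k] leaves a square at most
   [d k ^+ 2 / 2], hence [phi < d k] and [N < 2 * d k]. *)
pose eps k := c * d k ^+ 3 / 2.
have eps0 k : 0 < eps k by rewrite divr_gt0// mulr_gt0// exprn_gt0.
(* Besides being nearly minimal, the new point does not raise the value at the old one. As a bump
   vanishes at its own centre, [v] decreases. The premises sit under the existential so that
   [choice] applies. *)
have selP k (f : E -> R) x : exists x', (forall u, D u -> - (s * eta) <= f u) -> D x ->
    [/\ D x', f x' <= f x & forall u, D u -> f x' <= f u + eps k].
  have [[fge Dx]|h] := pselect ((forall u, D u -> - (s * eta) <= f u) /\ D x); last first.
    by exists x => fge Dx; case: h.
  have fD0 : [set f u | u in D] !=set0 by exists (f x); exists x.
  have fl : has_lbound [set f u | u in D].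
    by exists (- (s * eta)) => _ [u Du <-]; exact: fge.
  have hinf u : D u -> inf [set f u | u in D] <= f u.
    by move=> Du; apply: ge_inf => //; exists u.
  have [xe|xe] := lerP (f x) (inf [set f u | u in D] + eps k).
    by exists x; split => // u Du; apply: (le_trans xe); rewrite lerD2r hinf.
  have [_ [x' Dx' <-] h] : exists2 y, [set f u | u in D] y & y < inf [set f u | u in D] + eps k.
    by apply: inf_lt => //; rewrite ltrDl.
  exists x'; split => // [|u Du]; first by rewrite ltW// (lt_trans h).
  by rewrite (le_trans (ltW h))// lerD2r hinf.
have [sel0 sel0P] := choice (fun a : nat * (E -> R) * E => selP a.1.1 a.1.2 a.2).
pose sel k f x := sel0 (k, f, x).
have {}selP k f x : (forall u, D u -> - (s * eta) <= f u) -> D x ->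
    [/\ D (sel k f x), f (sel k f x) <= f x & forall u, D u -> f (sel k f x) <= f u + eps k].
  exact: (sel0P (k, f, x)).
pose bump k x u := c * d k * Num.max (phi (d k) (u - x)) 0 ^+ 2.
pose st := fix st k : (E -> R) * E := if k is k'.+1 then
    let f := fun u => (st k').1 u + bump k' (st k').2 u in (f, sel k f (st k').2)
  else let f := fun u => g u + s * phi eta (u - z0) in (f, sel 0%N f z0).
pose f_ k := (st k).1; pose x_ k := (st k).2.
have fE k u : f_ k u = g u + perturbation phi s c eta z0 x_ k u.
  rewrite /perturbation; elim: k => [|k IH]; first by rewrite big_ord0 addr0.
  rewrite big_ord_recr/= -[f_ k.+1 u]/(f_ k u + bump k (x_ k) u) IH !addrA; congr (_ + _).
have bump0 k x u : 0 <= bump k x u by rewrite mulr_ge0 ?sqr_ge0// mulr_ge0// ltW.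
have f0ge u : D u -> g u + s * (N (u - z0) - eta) <= f_ 0%N u.
  by move=> Du; rewrite /f_/= lerD2l ler_pM2l//; case/andP: (phiN eta (u - z0) eta0).
have f_mono k j u : (k <= j)%N -> f_ k u <= f_ j u.
  move=> /subnK <-; elim: (j - k)%N => [|n IH]; first by rewrite add0n.
  by rewrite addSn; apply: (le_trans IH); rewrite {2}/f_/= lerDl.
have f_ge k u : D u -> - (s * eta) <= f_ k u.
  move=> Du; apply: le_trans (f_mono _ _ _ (leq0n k)); apply: le_trans (f0ge _ Du).
  have := g0 _ Du; have := seminorm_ge0 (u - z0) sN => h1 h2.
  have : 0 <= s * N (u - z0) by rewrite mulr_ge0// ltW.
  by rewrite mulrBr; lra.
have Dx k : D (x_ k).
  elim: k => [|k IH]; first by have [] := selP 0%N (f_ 0%N) z0 (f_ge 0%N) Dz0.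
  by have [] := selP k.+1 (f_ k.+1) (x_ k) (f_ge k.+1) IH.
have x_min k u : D u -> f_ k (x_ k) <= f_ k u + eps k.
  case: k => [|k]; first by have [_ _] := selP 0%N (f_ 0%N) z0 (f_ge 0%N) Dz0; exact.
  by have [_ _] := selP k.+1 (f_ k.+1) (x_ k) (f_ge k.+1) (Dx k); exact.
have phi_le0 e : 0 < e -> phi e 0 <= 0.
  by move=> e0; have /andP[_] := phiN _ 0 e0; rewrite (seminorm0 sN).
have bump_x k : bump k (x_ k) (x_ k) = 0.
  by rewrite /bump subrr (max_idPr _) ?phi_le0// expr0n/= mulr0.
pose v k := f_ k (x_ k).
have v_S k : v k.+1 <= v k.
  have [_ + _] := selP k.+1 (f_ k.+1) (x_ k) (f_ge k.+1) (Dx k).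
  by rewrite {3}/f_/= -/(x_ k) bump_x addr0.
have v_mono k j : (k <= j)%N -> v j <= v k.
  move=> /subnK <-; elim: (j - k)%N => [|n IH]; first by rewrite add0n.
  by rewrite addSn (le_trans (v_S _)).
have v0 : v 0%N <= g z0.
  have [_ + _] := selP 0%N (f_ 0%N) z0 (f_ge 0%N) Dz0.
  move/le_trans; apply; rewrite /f_/= subrr gerDl.
  by rewrite -oppr_ge0 -mulrN mulr_ge0 ?(ltW s0)// oppr_ge0 phi_le0.
have close k j : (k < j)%N -> N (x_ j - x_ k) < 2 * d k.
  move=> kj.
  have h1 : f_ k.+1 (x_ j) <= v k by apply: le_trans (f_mono _ _ _ kj) (v_mono _ _ (ltnW kj)).
  have h2 : bump k (x_ k) (x_ j) <= eps k.
    have := x_min k _ (Dx j); move: h1; rewrite /v {1}/f_/= -/(f_ k) -/(x_ k); lra.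
  have h3 : Num.max (phi (d k) (x_ j - x_ k)) 0 < d k.
    rewrite -(@ltr_pXn2r _ 2)// ?nnegrE ?le_max ?lexx ?orbT ?ltW//.
    move: h2; rewrite /bump /eps -mulrA -mulrA ler_pM2l// exprS -mulrA ler_pM2l//.
    have : 0 < d k ^+ 2 by rewrite exprn_gt0.
    lra.
  have := phiN _ (x_ j - x_ k) (d0 k) => /andP[h4 _].
  move: h3; rewrite gt_max => /andP[h3 _]; lra.
have [z xz] : exists z : E, x_ @ \oo --> z.
  apply: cplE => e e0.
  have [k /(_ k (leqnn k)) hk] := half_power_lt (divr_gt0 (mulr_gt0 cN0 e0) (ltr0n _ 2)).
  exists k => j; rewrite leq_eqVlt => /predU1P[<-|kj]; first by rewrite subrr normr0.
  rewrite -(ltr_pM2l cN0); apply: (le_lt_trans (NcN _)).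
  by apply: (lt_trans (close _ _ kj)); rewrite /d; lra.
have Dz : D z.
  by apply: (@closed_cvg _ _ _ _ _ D cD _ _ xz); exists 0%N.
have cphi e : 0 < e -> continuous (phi e).
  by move=> e0; apply: (nonexpansive_continuous eN) => x h; exact: phiL.
have cf k : continuous (f_ k).
  elim: k => [|k IH] x; rewrite /f_/=.
    apply: cvgD; first exact: cg.
    apply: cvgMr; apply: (@cvg_comp _ _ _ (fun u => u - z0) (phi eta)); last exact: cphi.
    by apply: cvgB; [exact: cvg_id|exact: cvg_cst].
  apply: cvgD; first exact: IH.
  have hm : continuous (fun u => Num.max (phi (d k) (u - x_ k)) 0).
    apply: (nonexpansive_continuous eN) => u h.
    have := phiL _ (u - x_ k) h (d0 k); have := seminorm_ge0 h sN.
    rewrite [u - x_ k + h]addrAC /Num.max => h1 h2; do 2 case: ltP => ?; lra.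
  apply: cvgMr; rewrite expr2; under eq_fun do rewrite expr2.
  by apply: cvgM; exact: hm.
(* For [i] beyond both indices, [f_ k (x_ i) <= v i <= v j]; the passage to the limit uses
   continuity of the finite sum [f_ k] alone. *)
have fz k j : f_ k z <= v j.
  apply: (continuous_le_lim (k := maxn k j) (cf k) xz) => i; rewrite geq_max => /andP[ki ji].
  exact: le_trans (f_mono _ _ _ ki) (v_mono _ _ ji).
have fzg : g z + s * (N (z - z0) - eta) <= g z0.
  exact: le_trans (f0ge _ Dz) (le_trans (fz 0%N 0%N) v0).
exists s, c, eta, z, x_; split.
- by split => //; rewrite /c; lra.
- split => //.
    have : s * (N (z - z0) - eta) <= g z0 by have := g0 _ Dz; lra.
    by rewrite -ler_pdivlMl// mulrC; lra.
  have : 0 <= s * N (z - z0) by exact: mulr_ge0 (ltW s0) (seminorm_ge0 _ sN).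
  by move: fzg; rewrite mulrBr; lra.
- move=> k.
  have cNk : continuous (fun u => N (u - x_ k)).
    apply: (nonexpansive_continuous eN) => u h.
    by have := sN.1 (u - x_ k) h; rewrite addrAC; lra.
  apply: (continuous_le_lim (k := k.+1) cNk xz) => i ki.
  exact/ltW/close.
- move=> u k Du; rewrite -!fE (le_trans (fz k k))// (le_trans (x_min _ _ Du))// lerD2l.
  rewrite /eps -mulrA ler_pM2l// -/(d k).
  have : d k ^+ 3 <= d k by rewrite -[leRHS]expr1 ler_wiXn2l// ?exprn_ile1 ?ltW ?d0//; lra.
  have := d0 k; lra.
Qed.

End variational_principle.

(** * Smooth approximation of norms *)

Section dual_functionals.
Context {R : realType} {E : normedModType R}.
Implicit Types (N : E -> R) (f : dual E).

Lemma dual_le f x : f x <= `|f| * `|x|.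
Proof.
have [->|x0] := eqVneq x 0; first by rewrite linear0 normr0 mulr0.
have nx0 : 0 < `|x| by rewrite normr_gt0.
rewrite -ler_pdivrMr// mulrC -[_ * f x]linearZ.
apply: le_trans (ler_norm _) _; apply: dual_norm_ub.
by rewrite normrZ normfV normr_id mulVf// gt_eqF.
Qed.

Lemma dual_norm_le_of f (M : R) : 0 <= M -> (forall x, f x <= M * `|x|) -> `|f| <= M.
Proof.
move=> M0 fM; apply: dual_norm_le => x x1.
have Mx : M * `|x| <= M by rewrite ler_piMr.
have := fM x; have := fM (- x); rewrite normrN linearN => h1 h2.
by rewrite ler_norml; apply/andP; split; lra.
Qed.

Lemma sandwich_dual N (T : set (E * R)) : equivalent_norm N -> T !=set0 ->
  (forall w r w' r', T (w, r) -> T (w', r') -> T (w + w', r + r')) ->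
  (forall t w r, 0 < t -> T (w, r) -> T (t *: w, t * r)) ->
  (forall w r, T (w, r) -> 0 <= r + N w) ->
  exists2 f : dual E, forall x, f x <= N x & forall w r, T (w, r) -> f w <= r.
Proof.
move=> [sN _ [K K0 NK]] T0 TD TZ TN.
have [a [la aN aT]] := sandwich sN T0 TD TZ TN.
suff ac : a \in @continuous_linear R E by exists (Dual ac).
rewrite inE; split => //.
have aB x y : a (x - y) = a x - a y.
  by rewrite -scaleN1r addrC la scaleN1r addrC.
move=> x; apply/cvgrPdist_le => e e0; near=> y.
have hy : K * `|x - y| <= e.
  rewrite -ler_pdivlMl// mulrC; near: y; apply: cvgr_dist_le => //.
  by rewrite divr_gt0.
have h1 := aN (x - y); have h2 := aN (y - x); have hK := NK (x - y).
have hN : N (y - x) = N (x - y) by rewrite -(seminormN (x - y))// opprB.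
move: h1 h2; rewrite !aB => h1 h2.
by rewrite ler_norml; apply/andP; split; lra.
Unshelve. all: by end_near. Qed.

(** A sandwich for the ray through [(- x, - N x)]: the constraint there is exactly [N x <= f x]. *)
Lemma norming_functional N x : equivalent_norm N ->
  exists2 f : dual E, forall y, f y <= N y & f x = N x.
Proof.
move=> eN; have sN : seminorm N by case: eN.
pose T : set (E * R) := [set wr | exists2 t, 0 < t & wr = (- (t *: x), - (t * N x))].
have [|||w r|f fN fT] := @sandwich_dual N T eN.
- by exists (- (1 *: x), - (1 * N x)), 1.
- move=> _ _ _ _ [t t0 [-> ->]] [s s0 [-> ->]]; exists (t + s); first exact: addr_gt0.
  by rewrite scalerDl mulrDl !opprD.
- move=> t _ _ t0 [s s0 [-> ->]]; exists (t * s); first exact: mulr_gt0.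
  by rewrite scalerN scalerA mulrN mulrA.
- by move=> [t t0 [-> ->]]; rewrite seminormN// sN.2 gtr0_norm// addNr.
exists f => //; apply/eqP; rewrite eq_le fN/=.
have := fT (- (1 *: x)) (- (1 * N x)); rewrite scale1r mul1r linearN lerN2; apply.
by exists 1; rewrite ?scale1r ?mul1r.
Qed.

End dual_functionals.

Lemma average_deficit (R : realFieldType) (f p q k : R) :
  f - k <= p -> f - k <= q -> f - (p + q) / 2 <= k.
Proof. lra. Qed.

Lemma maximizer_value (R : realFieldType) (f p ta tb t e : R) :
  ta <= tb + e / 2 -> tb <= t -> f - e / 2 <= p - t -> f + ta - e <= p.
Proof. lra. Qed.

Lemma midpoint_value (R : realFieldType) (p q t tp tq t' eta f : R) : 0 < eta ->
  t <= (tp + tq) / 2 - t' -> 2^-1 * (p + q) - eta * t <= f ->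
  eta * t' <= f - (p - eta * tp + (q - eta * tq)) / 2.
Proof. by move=> /ltW eta0 /(ler_wpM2l eta0); lra. Qed.

(* [phi] below is the conjugate of the indicator of the unit ball of [N^*] plus
   [eta * Theta], where [Theta = \sum_n w_n |. - d_n|^2].  Convexity of squared
   norms makes every maximizing sequence for [phi x] converge in norm: the
   distances to each [d_n] converge, and the [d_n] are dense. *)
Section smooth_approximation.
Context {R : realType} {E : normedModType R}.
Variables (N : E -> R) (K : R) (d : nat -> dual E) (eta : R).
Hypotheses (eN : equivalent_norm N) (K0 : 0 < K) (NK : forall x, N x <= K * `|x|).
Hypothesis d_dense : forall (f : dual E) e, 0 < e -> exists n, `|f - d n| < e.
Hypothesis eta0 : 0 < eta.
Implicit Types (a b f : dual E) (x y h : E).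

Let sN : seminorm N. Proof. by case: eN. Qed.

Let ball_ := [set f : dual E | forall x, f x <= N x].

(** Normalized so that on the dual ball, where [|f - d n| <= K + |d n|], the [n]-th term is at most
    [2^-1 ^+ n.+1] and [Theta] stays in [[0, 1]]. *)
Let w n : R := 2^-1 ^+ n.+1 / (K + `|d n|) ^+ 2.
Let Theta_ m f := \sum_(n < m) w n * `|f - d n| ^+ 2.
Let Theta f := sup [set Theta_ m f | m in setT].
Let V x f := f x - eta * Theta f.
Let phi x := sup [set V x f | f in ball_].

Let L0 n : 0 < K + `|d n|. Proof. by rewrite ltr_wpDr. Qed.

Let w_gt0 n : 0 < w n.
Proof. by rewrite divr_gt0// exprn_gt0// invr_gt0. Qed.

Let ball_norm f n : ball_ f -> `|f - d n| <= K + `|d n|.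
Proof.
move=> fN; apply: (le_trans (ler_normB _ _)); rewrite lerD2r.
by apply: dual_norm_le_of; [exact: ltW|move=> x; exact: le_trans (fN x) (NK x)].
Qed.

Let Theta_term_ge0 n f : 0 <= w n * `|f - d n| ^+ 2.
Proof. by rewrite mulr_ge0 ?sqr_ge0// ltW. Qed.

Let Theta_mono m n f : (m <= n)%N -> Theta_ m f <= Theta_ n f.
Proof.
move=> /subnK <-; elim: (n - m)%N => [|k IH]; first by rewrite add0n.
by rewrite addSn (le_trans IH)// /Theta_ big_ord_recr/= lerDl.
Qed.

Let Theta_le1 m f : ball_ f -> Theta_ m f <= 1.
Proof.
move=> bf; suff : Theta_ m f <= 1 - 2^-1 ^+ m.
  by move/le_trans; apply; rewrite gerBl exprn_ge0// invr_ge0.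
elim: m => [|m IH]; first by rewrite /Theta_ big_ord0 expr0 subrr.
rewrite /Theta_ big_ord_recr/= -/(Theta_ m f).
have : w m * `|f - d m| ^+ 2 <= 2^-1 ^+ m.+1.
  rewrite /w -mulrA ler_piMr ?exprn_ge0 ?invr_ge0//.
  rewrite mulrC ler_pdivrMr ?exprn_gt0// mul1r.
  by rewrite ler_pXn2r ?nnegrE ?ball_norm// ltW.
rewrite [2^-1 ^+ m.+1]exprS; lra.
Qed.

Let Theta_ub f : ball_ f -> has_ubound [set Theta_ m f | m in setT].
Proof. by move=> bf; exists 1 => _ [m _ <-]; exact: Theta_le1. Qed.

Let Theta_le m f : ball_ f -> Theta_ m f <= Theta f.
Proof. by move=> bf; apply: ub_le_sup; [exact: Theta_ub|exists m]. Qed.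

Let Theta_lub f M : (forall m, Theta_ m f <= M) -> Theta f <= M.
Proof.
by move=> h; apply: ge_sup; [exists (Theta_ 0%N f); exists 0%N|move=> _ [m _ <-]].
Qed.

Let Theta_bounds f : ball_ f -> 0 <= Theta f <= 1.
Proof.
move=> bf; apply/andP; split; last by apply: Theta_lub => m; exact: Theta_le1.
by apply: le_trans (Theta_le 0 bf); rewrite /Theta_ big_ord0.
Qed.

Let V_bounds x f : ball_ f -> f x - eta <= V x f <= f x.
Proof.
move=> /Theta_bounds/andP[h0 h1]; rewrite /V gerBl mulr_ge0// ?(ltW eta0)// andbT.
by rewrite lerD2l lerN2 ler_piMr// ltW.
Qed.

Let ball0 : ball_ !=set0.
Proof. by have [f fN _] := norming_functional 0 eN; exists f. Qed.

Let V_le x f : ball_ f -> V x f <= phi x.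
Proof.
move=> bf; apply: ub_le_sup; last by exists f.
by exists (N x) => _ [g bg <-]; have /andP[_ /le_trans] := V_bounds x bg; apply.
Qed.

Let phi_lt x r : r < phi x -> exists2 f, ball_ f & r < V x f.
Proof.
move=> /sup_gt[|_ [f bf <-] rf]; last by exists f.
by case: ball0 => f bf; exists (V x f); exists f.
Qed.

Let phi_lub x M : (forall f, ball_ f -> V x f <= M) -> phi x <= M.
Proof.
move=> h; apply: ge_sup; last by move=> _ [f bf <-]; exact: h.
by case: ball0 => f bf; exists (V x f); exists f.
Qed.

Let phi_bounds x : N x - eta <= phi x <= N x.
Proof.
apply/andP; split; last first.
  by apply: phi_lub => f bf; have /andP[_ /le_trans] := V_bounds x bf; apply.
have [f bf <-] := norming_functional x eN.
by have /andP[h _] := V_bounds x bf; exact: le_trans h (V_le x bf).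
Qed.

Let phi_lip x h : phi (x + h) - phi x <= N h.
Proof.
rewrite lerBlDr; apply: phi_lub => f bf.
by have := V_le x bf; have := bf h; rewrite /V linearD; lra.
Qed.

(** The midpoint of [a] and [b] competes in the supremum [phi x], and [((p + q) / 2) ^+ 2 + (p - q)
    ^+ 2 / 4 = (p ^+ 2 + q ^+ 2) / 2] gives its gain over the average of [V x a] and [V x b]. *)
Let midpoint x a b n : ball_ a -> ball_ b ->
  eta * (w n * ((`|a - d n| - `|b - d n|) ^+ 2 / 4)) <= phi x - (V x a + V x b) / 2.
Proof.
move=> ba bb; pose m := 2^-1 *: (a + b).
have mE y : m y = 2^-1 * (a y + b y) by rewrite /m dualZ dualD.
have bm : ball_ m by move=> y; have := ba y; have := bb y; rewrite mE; lra.
pose D k := (`|a - d k| - `|b - d k|) ^+ 2 / 4.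
have term k : `|m - d k| ^+ 2 + D k <= (`|a - d k| ^+ 2 + `|b - d k| ^+ 2) / 2.
  have h : `|m - d k| <= (`|a - d k| + `|b - d k|) / 2.
    have -> : m - d k = 2^-1 *: ((a - d k) + (b - d k)).
      rewrite /m addrACA -opprD scalerBr; congr (_ - _).
      by rewrite -mulr2n -[d k *+ 2]scaler_nat scalerA mulVf// scale1r.
    by rewrite normrZ ger0_norm ?invr_ge0// mulrC ler_pM2r ?invr_gt0// ler_normD.
  have : `|m - d k| ^+ 2 <= ((`|a - d k| + `|b - d k|) / 2) ^+ 2.
    by rewrite ler_pXn2r ?nnegrE// divr_ge0// addr_ge0.
  rewrite /D; move: (`|m - d k| ^+ 2) (`|a - d k|) (`|b - d k|) => r p q; lra.
have D0 k : 0 <= D k by rewrite divr_ge0 ?sqr_ge0.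
have sumD M : Theta_ M m + \sum_(k < M) w k * D k <= (Theta_ M a + Theta_ M b) / 2.
  rewrite /Theta_ -!big_split/= mulr_suml ler_sum// => k _.
  by rewrite -!mulrDr -mulrA ler_pM2l.
(* Partial sums up to [maxn M n.+1] are sure to contain the [n]-th term, whose gain is to be
   kept. *)
have Th : Theta m <= (Theta a + Theta b) / 2 - w n * D n.
  apply: Theta_lub => M.
  have h1 := Theta_mono m (leq_maxl M n.+1).
  have := sumD (maxn M n.+1).
  have := Theta_le (maxn M n.+1) ba; have := Theta_le (maxn M n.+1) bb.
  suff : w n * D n <= \sum_(k < maxn M n.+1) w k * D k.
    move: h1; move: (\sum_(k < _) _) (Theta_ _ m) (Theta_ _ m) (Theta_ _ a) (Theta_ _ b).
    move: (Theta a) (Theta b) (w n * D n) => *; lra.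
  have nM : (n < maxn M n.+1)%N by rewrite leq_maxr.
  rewrite (bigD1 (Ordinal nM))//= lerDl sumr_ge0// => k _.
  by rewrite mulr_ge0// ltW.
apply: (@midpoint_value _ _ _ (Theta m)) => //.
by rewrite -mE; exact: V_le.
Qed.

Let near_max x kap := [set f | ball_ f /\ phi x - kap <= V x f].

Let near_max0 x kap : 0 < kap -> near_max x kap !=set0.
Proof.
move=> kap0; have [|f bf fk] := @phi_lt x (phi x - kap); first by rewrite ltrBlDr ltrDl.
by exists f; split => //; exact: ltW.
Qed.

Let near_max_dist x n e : 0 < e -> exists2 kap, 0 < kap &
  forall a b, near_max x kap a -> near_max x kap b -> `|a - d n| <= `|b - d n| + e.
Proof.
move=> e0; exists (eta * (w n * (e ^+ 2 / 4))).
  by rewrite mulr_gt0// mulr_gt0// divr_gt0// exprn_gt0.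
move=> a b [ba ha] [bb hb]; rewrite leNgt; apply/negP => he.
have h : e < `|a - d n| - `|b - d n| by rewrite ltrBrDl.
have := le_trans (midpoint x n ba bb) (average_deficit ha hb).
rewrite !ler_pM2l// leNgt => /negP; apply.
by rewrite ltr_pM2r ?invr_gt0// ltr_pXn2r ?nnegrE ?(ltW e0) ?(ltW (lt_trans e0 h)).
Qed.

(** Hahn-Banach in place of a weak-star cluster point: [T] collects the pairs [(y, r)] such that
    [b y <= r] for all sufficiently good near-maximizers [b], so [a] lies below their upper limit in
    every direction. Distances to the [d n], and with them [Theta_ m], are then lower semicontinuous
    at [a]. *)
Let maximizer x : exists2 a, ball_ a & phi x <= V x a.
Proof.
pose T : set (E * R) := [set wr | exists2 kap, 0 < kap &
  forall b, near_max x kap b -> b wr.1 <= wr.2].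
have near_sub k1 k2 b : k1 <= k2 -> near_max x k1 b -> near_max x k2 b.
  by move=> k12 [bb hb]; split => //; apply: le_trans hb; rewrite lerD2l lerN2.
have [|||y r|a ba aT] := @sandwich_dual R E N T eN.
- by exists (0, 0), 1 => //= b _; rewrite linear0.
- move=> y r y' r' [k k0 /= h] [k' k'0 /= h'].
  exists (Num.min k k'); first by rewrite lt_min k0.
  by move=> b nb /=; rewrite linearD lerD ?h ?h'//; apply: near_sub nb; rewrite ge_min lexx ?orbT.
- move=> t y r t0 [k k0 /= h]; exists k => // b nb /=.
  by rewrite linearZ ler_pM2l ?h.
- move=> [k k0 /= h]; have [b nb] := near_max0 x k0.
  by have := h _ nb; have := nb.1 (- y); rewrite linearN seminormN//; lra.
have da n e : 0 < e -> exists2 kap, 0 < kap &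
    forall b, near_max x kap b -> `|a - d n| <= `|b - d n| + e.
  move=> e0; have [k k0 hk] := near_max_dist x n e0; exists k => // b nb.
  apply: dual_norm_le_of => [|y]; first by rewrite addr_ge0// ltW.
  rewrite dualD -[(- d n) y]/(- d n y) lerBlDr; apply: aT; exists k => // b' nb' /=.
  have := dual_le (b' - d n) y; rewrite dualD -[(- d n) y]/(- d n y).
  have := ler_wpM2r (normr_ge0 y) (hk _ _ nb' nb); lra.
have Tha m e : 0 < e -> exists2 kap, 0 < kap &
    forall b, near_max x kap b -> Theta_ m a <= Theta_ m b + e.
  elim: m e => [|m IH] e e0.
    by exists 1 => // b _; rewrite /Theta_ !big_ord0 add0r ltW.
  have [k k0 hk] := IH (e / 2) (divr_gt0 e0 (ltr0n _ 2)).
  pose L := K + `|d m|.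
  have C0 : 0 < w m * (2 * L + 1).
    by rewrite mulr_gt0// addr_gt0// mulr_gt0// /L.
  (* For [0 <= p <= L] and [0 <= t <= 1], [(p + t) ^+ 2] exceeds [p ^+ 2] by at most
     [(2 * L + 1) * t]. *)
  pose t := Num.min 1 (e / 2 / (w m * (2 * L + 1))).
  have t0 : 0 < t by rewrite lt_min ltr01 !divr_gt0.
  have t1 : t <= 1 by rewrite ge_min lexx.
  have t2 : t * (w m * (2 * L + 1)) <= e / 2.
    by rewrite -ler_pdivlMr// ge_min lexx orbT.
  have [k' k'0 hk'] := da m t t0.
  exists (Num.min k k'); first by rewrite lt_min k0.
  move=> b nb.
  have nb1 : near_max x k b by apply: near_sub nb; rewrite ge_min lexx.
  have nb2 : near_max x k' b by apply: near_sub nb; rewrite ge_min lexx orbT.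
  rewrite /Theta_ !big_ord_recr/= -/(Theta_ m a) -/(Theta_ m b).
  have h1 := hk _ nb1; have h2 := hk' _ nb2; have h3 := ball_norm m nb.1.
  suff : w m * `|a - d m| ^+ 2 <= w m * `|b - d m| ^+ 2 + e / 2 by lra.
  apply: le_trans (lerD (lexx _) t2).
  rewrite [t * _]mulrCA -mulrDr ler_pM2l//.
  apply: (@le_trans _ _ ((`|b - d m| + t) ^+ 2)).
    by rewrite ler_pXn2r ?nnegrE// addr_ge0// ltW.
  have h4 : t * `|b - d m| <= t * L by rewrite ler_pM2l.
  have h5 : t * t <= t by rewrite ler_piMr// ltW.
  rewrite sqrrD -mulr_natr expr2; lra.
exists a => //.
have fx m : phi x + eta * Theta_ m a <= a x.
  apply/ler_addgt0Pr => e e0.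
  have e20 : 0 < e / 2 by rewrite divr_gt0.
  have [k k0 hk] := Tha m (e / 2 / eta) (divr_gt0 e20 eta0).
  have := aT (- x) (- (phi x + eta * Theta_ m a - e)); rewrite linearN lerN2 lerBlDr.
  apply; exists (Num.min k (e / 2)); first by rewrite lt_min k0.
  move=> b nb /=; rewrite linearN lerN2.
  have nb1 : near_max x k b by apply: near_sub nb; rewrite ge_min lexx.
  have [bb nb2] : near_max x (e / 2) b by apply: near_sub nb; rewrite ge_min lexx orbT.
  have h1 := ler_wpM2l (ltW eta0) (hk _ nb1).
  have h2 := ler_wpM2l (ltW eta0) (Theta_le m bb).
  move: h1 h2 nb2; rewrite mulrDr [eta * (_ / eta)]mulrC divfK ?gt_eqF// /V.
  exact: maximizer_value.
rewrite lerBrDr -lerBrDl -ler_pdivlMl//; apply: Theta_lub => m.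
by rewrite ler_pdivlMl// lerBrDl.
Qed.

Let strong_max x : exists2 a, ball_ a & forall e, 0 < e -> exists2 kap, 0 < kap &
  forall b, near_max x kap b -> `|b - a| <= e.
Proof.
have [a ba ha] := maximizer x; exists a => // e e0.
have e30 : 0 < e / 3 by rewrite divr_gt0.
have [n an] := d_dense a e30.
have [k k0 hk] := near_max_dist x n e30; exists k => // b nb.
have : near_max x k a by split => //; rewrite (le_trans _ ha)// gerBl ltW.
move=> /(hk _ _ nb) h.
have -> : b - a = (b - d n) - (a - d n) by rewrite opprB addrA subrK.
apply: (le_trans (ler_normB _ _)); lra.
Qed.

(** A near-maximizer for [x + h] is also one for [x] when [h] is small, hence close in norm to the
    strong maximizer [a] at [x]; replacing it by [a] in its value at [h] costs a small multiple of
    [|h|]. *)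
Lemma smooth_approximation : exists phi : E -> R,
  [/\ forall x, N x - eta <= phi x <= N x,
    forall x h, phi (x + h) - phi x <= N h &
    forall x, exists2 a : dual E, forall y, a y <= N y &
      forall e, 0 < e -> exists2 r, 0 < r &
        forall h, `|h| < r -> phi (x + h) <= phi x + a h + e * `|h| ].
Proof.
exists phi; split => // x.
have [a ba amax] := strong_max x; exists a => // e e0.
have e20 : 0 < e / 2 by rewrite divr_gt0.
have [k k0 hk] := amax _ e20.
have C0 : 0 < 2 * K + e / 2 by rewrite addr_gt0// mulr_gt0.
(* Passing from [x + h] to [x] loses [N h] in [phi], [N h] in the functional, and the deficit
   [e / 2 * |h|] of the near-maximizer. *)
exists (k / (2 * K + e / 2)) => [|h]; first exact: divr_gt0.
rewrite ltr_pdivlMr// => hr.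
have [->|h0] := eqVneq h 0; first by rewrite linear0 normr0 mulr0 !addr0.
have nh0 : 0 < `|h| by rewrite normr_gt0.
have [|b bb hb] := @phi_lt (x + h) (phi (x + h) - e / 2 * `|h|).
  by rewrite ltrBlDr ltrDl mulr_gt0.
have VD : V (x + h) b = V x b + b h by rewrite /V linearD; lra.
have h1 := phi_lip (x + h) (- h); rewrite addrK (seminormN h sN) in h1.
have h2 := bb h; have h3 := NK h.
have : near_max x k b.
  split => //; move: h1 h2 h3 hr hb; rewrite VD.
  lra.
move=> /hk hba; have := dual_le (b - a) h.
rewrite dualD -[(- a) h]/(- a h).
have := V_le x bb; have := ler_wpM2r (ltW nh0) hba; move: hb; rewrite VD; lra.
Qed.

End smooth_approximation.

(** * Perturbed minimizers and their slopes *)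

Lemma increment_step (R : realFieldType) (C p p' m t ts n : R) :
  C * m <= C * (t + ts + n) -> p' + C * m - (p + C * t) <= p' - p + C * (ts + n).
Proof. lra. Qed.

Lemma tail_step (R : realFieldType) (c d d' p p' b n : R) :
  p' <= p + c * d * b -> b <= 5 * n -> 0 <= c * d -> d = 2 * d' ->
  p' + 10 * c * d' * n <= p + 10 * c * d * n.
Proof. by move=> h1 h2 cd dE; have := ler_wpM2l cd h2; rewrite dE in h1 *; lra. Qed.

Lemma gradient_step (R : realFieldType) (C t f n a v e r : R) :
  C * (t * v) <= e / 4 * r -> C * (t * f) <= C * (t * (a + v)) -> C * n <= e / 4 * r ->
  C * (t * f + n) <= C * t * a + e / 2 * r.
Proof. lra. Qed.

Section perturbation_increments.
Context {R : realType} {E : normedModType R}.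
Variables (N : E -> R) (phi : R -> E -> R) (s c eta : R) (z0 : E) (x_ : nat -> E) (z : E).
Hypotheses (sN : seminorm N) (s0 : 0 < s) (c0 : 0 < c).
Hypothesis phi_le : forall eta x, 0 < eta -> phi eta x <= N x.
Hypothesis phi_lip : forall eta x h, 0 < eta -> phi eta (x + h) - phi eta x <= N h.
Hypothesis x_z : forall k, N (z - x_ k) <= 2 * 2^-1 ^+ k.

Let d (k : nat) : R := 2^-1 ^+ k.
Let P k u := perturbation phi s c eta z0 x_ k u.

Let d0 k : 0 < d k. Proof. by rewrite exprn_gt0// invr_gt0. Qed.
Let d1 k : d k <= 1. Proof. by rewrite exprn_ile1 ?invr_ge0// invf_le1// ler1n. Qed.
Let dS k : d k = 2 * d k.+1. Proof. by rewrite /d exprS mulrA mulfV// mul1r. Qed.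

Let tail_ge0 k h : 0 <= 10 * c * d k * N h.
Proof. by apply: mulr_ge0 (seminorm_ge0 h sN); rewrite ltW// !mulr_gt0. Qed.

Let t k := Num.max (phi (d k) (z - x_ k)) 0.

Let t0 k : 0 <= t k. Proof. by rewrite le_max lexx orbT. Qed.

Let t_le k : t k <= 2 * d k.
Proof.
rewrite ge_max (le_trans (phi_le _ (d0 k)) (x_z k))/=.
by rewrite mulr_ge0// ltW.
Qed.

(** Unlike the positive part, its square is continuously differentiable, with derivative
    [2 * max a 0] and a remainder bounded by the squared increment. *)
Lemma max0_sqr_increment (a b n : R) : `|b - a| <= n ->
  Num.max b 0 ^+ 2 <= Num.max a 0 ^+ 2 + 2 * Num.max a 0 * (b - a) + n ^+ 2.
Proof.
move=> ban; have : (b - a) ^+ 2 <= n ^+ 2.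
  by rewrite -(real_normK (num_real (b - a))) ler_pXn2r ?nnegrE// (le_trans _ ban).
rewrite /Num.max; case: ltP => hb; case: ltP => ha; nra.
Qed.

Let phi_dist e x h : 0 < e -> `|phi e (x + h) - phi e x| <= N h.
Proof.
move=> e0; rewrite ler_norml phi_lip// andbT.
by have := phi_lip (x + h) (- h) e0; rewrite addrK (seminormN h sN); lra.
Qed.

Let PS k u : P k.+1 u = P k u + c * d k * Num.max (phi (d k) (u - x_ k)) 0 ^+ 2.
Proof. by rewrite /P /perturbation big_ord_recr/= addrA. Qed.

Let P_step k h : P k.+1 (z + h) - P k.+1 z <=
  P k (z + h) - P k z +
  c * d k * (2 * t k * (phi (d k) (z - x_ k + h) - phi (d k) (z - x_ k)) + N h ^+ 2).
Proof.
have := max0_sqr_increment (phi_dist (z - x_ k) h (d0 k)).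
rewrite -(ler_pM2l (mulr_gt0 c0 (d0 k))) !PS [z + h - _]addrAC -/(t k).
exact: increment_step.
Qed.

(** As [t m <= 2 * d m <= 2] and [N h <= 1], the bump at stage [m] adds at most
    [(4 + 1) * c * d m * N h]. These add up to [10 * c * (d k - d j) * N h]; the terms with [10] on
    both sides express this telescoping. *)
Lemma perturbation_tail k h : N h <= 1 -> forall j, (k <= j)%N ->
  P j (z + h) - P j z + 10 * c * d j * N h <= P k (z + h) - P k z + 10 * c * d k * N h.
Proof.
move=> h1 j /subnK <-; elim: (j - k)%N => [|i IH]; first by rewrite add0n.
rewrite addSn; apply: le_trans IH; set m := (i + k)%N.
have Nh := seminorm_ge0 h sN.
have := P_step m h; have := phi_lip (z - x_ m) h (d0 m).
set s1 := (X in X <= N h -> _) => s1N.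
have h2 : 2 * t m * s1 + N h ^+ 2 <= 5 * N h.
  have : t m * s1 <= t m * N h by rewrite ler_wpM2l.
  have : t m * N h <= 2 * N h.
    by rewrite ler_wpM2r// (le_trans (t_le m))// -[leRHS]mulr1 ler_pM2l ?d1.
  have : N h * N h <= N h by rewrite ler_piMl.
  rewrite expr2; lra.
move=> h3; exact: tail_step h3 h2 (ltW (mulr_gt0 c0 (d0 m))) (dS m).
Qed.

(** The minimality error is removed by going to a late stage [j], and the tail estimate brings the
    perturbation back from [j] to [k]. *)
Lemma variational_limit (D : set E) (g : E -> R) :
  (forall u k, D u -> g z + P k z <= g u + P k u + c * d k) ->
  forall u k, D u -> N (u - z) <= 1 ->
  g z <= g u + (P k u - P k z) + 10 * c * d k * N (u - z).
Proof.
move=> gP u k Du uz; apply/ler_addgt0Pr => e e0.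
have [j kj je] : exists2 j, (k <= j)%N & c * d j < e.
  have ec0 : 0 < e / c by rewrite divr_gt0.
  have [j hj] := half_power_lt ec0; exists (maxn j k); first exact: leq_maxr.
  by rewrite mulrC -ltr_pdivlMr// hj// leq_maxl.
have := perturbation_tail uz kj; rewrite subrKC.
have : 0 <= 10 * c * d j * N (u - z).
  exact: tail_ge0.
have := gP u j Du; lra.
Qed.

Variable a_ : nat -> dual E.
Variable a0 : dual E.
Hypotheses (a0N : forall y, a0 y <= N y) (aN : forall k y, a_ k y <= N y).
Hypothesis a0P : forall e, 0 < e -> exists2 r, 0 < r &
  forall h, `|h| < r -> phi eta (z - z0 + h) <= phi eta (z - z0) + a0 h + e * `|h|.
Hypothesis aP : forall k e, 0 < e -> exists2 r, 0 < r &
  forall h, `|h| < r -> phi (d k) (z - x_ k + h) <= phi (d k) (z - x_ k) + a_ k h + e * `|h|.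

Definition gradient k : dual E := s *: a0 + \sum_(i < k)
  (c * 2^-1 ^+ i * (2 * Num.max (phi (2^-1 ^+ i) (z - x_ i)) 0)) *: a_ i.

Let gradientS k y : gradient k.+1 y = gradient k y + c * d k * (2 * t k) * a_ k y.
Proof.
have -> : gradient k.+1 = gradient k + (c * d k * (2 * t k)) *: a_ k.
  by rewrite /gradient big_ord_recr addrA.
by rewrite dualD dualZ.
Qed.

(** The coefficient of [a_ m] is at most [4 * c * d m], again because [t m <= 2]; summing the
    geometric series doubles the constant. *)
Lemma gradient_tail k j y : (k <= j)%N ->
  `|gradient j y - gradient k y| <= 8 * c * (d k - d j) * N y.
Proof.
move=> /subnK <-; elim: (j - k)%N => [|i IH]; first by rewrite add0n !subrr normr0 mulr0 mul0r.
rewrite addSn; set m := (i + k)%N in IH *.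
rewrite gradientS addrAC (le_trans (ler_normD _ _))//.
have am : `|a_ m y| <= N y.
  by rewrite ler_norml aN andbT lerNl -linearN -(seminormN y sN) aN.
have Ny := seminorm_ge0 y sN.
have : `|c * d m * (2 * t m) * a_ m y| <= c * d m * 4 * N y.
  have cd := mulr_gt0 c0 (d0 m).
  have ct : 0 <= c * d m * (2 * t m) by rewrite mulr_ge0 ?(ltW cd)// mulr_ge0.
  rewrite normrM (ger0_norm ct); apply: ler_pM => //; rewrite ler_pM2l//.
  by have := t_le m; have := d1 m; lra.
by rewrite {1}(dS m) (dS m) in IH *; move: IH; lra.
Qed.

Lemma gradient_le k y : gradient k y <= (s + 10 * c) * N y.
Proof.
have := gradient_tail y (leq0n k).
have g0 : gradient 0 y <= s * N y.
  by rewrite /gradient big_ord0 addr0 dualZ ler_pM2l.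
have Ny := seminorm_ge0 y sN.
have : 0 <= c * d k * N y by apply: mulr_ge0 => //; rewrite ltW// mulr_gt0.
have : 0 <= c * N y by rewrite mulr_ge0// ltW.
rewrite ler_norml /d expr0 => h1 h2 /andP[_]; lra.
Qed.

(** A one-sided estimate of [phi] survives the chain rule because the factor [2 * t k] is
    nonnegative. The radii let the error of [phi] and the quadratic remainder take [e / 4] each. *)
Lemma gradient_diff (K : R) k : 0 < K -> (forall y, N y <= K * `|y|) ->
  forall e, 0 < e -> exists2 r, 0 < r &
  forall h, `|h| < r -> P k (z + h) - P k z <= gradient k h + e * `|h|.
Proof.
move=> K0 NK; elim: k => [|k IH] e e0.
  have [r r0 hr] := a0P (divr_gt0 e0 s0); exists r => // h /hr.
  rewrite /P /perturbation !big_ord0 /gradient big_ord0 !addr0 dualZ [z + h - _]addrAC.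
  rewrite -(ler_pM2l s0) !mulrDr mulrA mulrCA divff ?gt_eqF// mulr1; lra.
have [r r0 hr] := IH _ (divr_gt0 e0 (ltr0n _ 2)).
have cd0 : 0 < c * d k by rewrite mulr_gt0.
have e1 : 0 < e / (c * d k * 16) by rewrite divr_gt0// mulr_gt0.
have [r' r'0 hr'] := aP k e1.
have e2 : 0 < e / (c * d k * 4 * K ^+ 2) by rewrite divr_gt0// !mulr_gt0// exprn_gt0.
exists (Num.min r (Num.min r' (e / (c * d k * 4 * K ^+ 2)))).
  by rewrite !lt_min r0 r'0 e2.
move=> h; rewrite !lt_min => /and3P[/hr h1 /hr' h2 h3].
apply: (le_trans (P_step k h)); rewrite gradientS.
suff : c * d k * (2 * t k * (phi (d k) (z - x_ k + h) - phi (d k) (z - x_ k)) + N h ^+ 2) <=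
    c * d k * (2 * t k) * a_ k h + e / 2 * `|h| by lra.
have h4 : c * d k * N h ^+ 2 <= e / 4 * `|h|.
  have : N h ^+ 2 <= (K * `|h|) ^+ 2.
    by rewrite ler_pXn2r ?nnegrE ?(seminorm_ge0 _ sN)// mulr_ge0// ltW.
  rewrite -(ler_pM2l cd0) => /le_trans; apply.
  rewrite exprMn [`|h| ^+ 2]expr2 !mulrA ler_wpM2r//.
  move: (ltW h3); rewrite ler_pdivlMr ?mulr_gt0// ?exprn_gt0//; lra.
have h5 : 2 * t k * (phi (d k) (z - x_ k + h) - phi (d k) (z - x_ k)) <=
    2 * t k * (a_ k h + e / (c * d k * 16) * `|h|).
  by rewrite ler_wpM2l ?mulr_ge0//; lra.
have h6 : 2 * t k * (e / (c * d k * 16) * `|h|) <= 4 * (e / (c * d k * 16) * `|h|).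
  apply: ler_wpM2r; first by rewrite mulr_ge0// ltW.
  by have := t_le k; have := d1 k; lra.
have h7 : c * d k * (4 * (e / (c * d k * 16) * `|h|)) = e / 4 * `|h|.
  by field; rewrite !gt_eqF.
have := ler_wpM2l (ltW cd0) h6; rewrite h7 => h8.
exact: gradient_step h8 (ler_wpM2l (ltW cd0) h5) h4.
Qed.

End perturbation_increments.

(** The constant [18] is [10] from the tail of the perturbation plus [8] from the tail of the
    gradients. *)
Lemma gradient_estimate (R : realFieldType) (gz gu p g0 gk c dk d0 n e r : R) :
  gz <= gu + p + 10 * c * d0 * n -> p <= g0 + e / 2 * r ->
  - (8 * c * (d0 - dk) * n) <= gk - g0 -> 0 <= c * dk * n ->
  18 * c * d0 * n <= e / 2 * r -> - gk <= gu - gz + e * r.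
Proof. lra. Qed.

Section variational_consequences.
Context {R : realType} {E : normedModType R}.
Variables (N : E -> R) (D : set E) (g : E -> R) (sigma lambda rho : R) (z0 : E).
Hypotheses (eN : equivalent_norm N) (cplE : @seq_complete R E) (cD : closed D).
Hypotheses (cg : continuous g) (g_ge0 : forall u, D u -> 0 <= g u).
Hypotheses (Dz0 : D z0) (sigma0 : 0 < sigma) (lambda0 : 0 < lambda) (rho0 : 0 < rho).
Hypothesis gz0 : g z0 < sigma * lambda.

Let sN : seminorm N. Proof. by case: eN. Qed.

(** Here [N] is its own approximation: the initial term has slope [s] and the bumps add [10 * c].
    The restriction [N (u - z) <= 1] makes the quadratic terms of the bumps at most linear. *)
Lemma local_ekeland : exists z, [/\ D z, N (z - z0) < lambda, g z < g z0 + rho &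
  forall u, D u -> N (u - z) <= 1 -> g z <= g u + sigma * N (u - z)].
Proof.
have NN eta x : 0 < eta -> N x - eta <= N x <= N x.
  by move=> eta0; rewrite lexx andbT gerBl ltW.
have NL (eta : R) x h : 0 < eta -> N (x + h) - N x <= N h.
  by move=> _; rewrite lerBlDl sN.1.
have [s [c [eta [z [x_ [[s0 c0 eta0 sc] [Dz zz0 gz] xz gP]]]]]] :=
  @variational_principle R E N D g (fun _ => N) sigma lambda rho z0
    eN cplE cD cg g_ge0 NN NL Dz0 sigma0 lambda0 rho0 gz0.
exists z; split => // u Du uz.
have N_le (e : R) x : 0 < e -> N x <= N x by [].
have := variational_limit sN c0 N_le NL xz gP 0%N Du uz.
have : perturbation (fun=> N) s c eta z0 x_ 0 u - perturbation (fun=> N) s c eta z0 x_ 0 z <=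
    s * N (u - z).
  rewrite /perturbation !big_ord0 !addr0 -mulrBr ler_pM2l// lerBlDr.
  by rewrite (le_trans _ (sN.1 _ _))// addrA subrK.
have := ler_wpM2r (seminorm_ge0 (u - z) sN) sc; rewrite expr0 mulrDl mulr1.
move: (perturbation _ _ _ _ _ _ _ _) (perturbation _ _ _ _ _ _ _ _) => p1 p2; lra.
Qed.

Variable d : nat -> dual E.
Hypothesis d_dense : forall (f : dual E) e, 0 < e -> exists n, `|f - d n| < e.

(** The [b k] are minus the gradients of the partial sums. The radius comes from one stage [k0] with
    a small tail; replacing the gradient at [k0] by a later one costs only that tail, which makes
    the estimate uniform in [k >= k0]. *)
Lemma smooth_variational : exists z (b : nat -> dual E), [/\ D z, N (z - z0) < lambda,
  g z < g z0 + rho, forall k y, b k y <= sigma * N y &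
  forall e, 0 < e -> exists2 r, 0 < r & exists k0, forall k u, (k0 <= k)%N ->
    D u -> `|u - z| < r -> b k (u - z) <= g u - g z + e * `|u - z| ].
Proof.
have [_ _ [K K0 NK]] := eN.
have smooth eta : exists phi : E -> R, 0 < eta ->
  [/\ forall x, N x - eta <= phi x <= N x,
    forall x h, phi (x + h) - phi x <= N h &
    forall x, exists2 a : dual E, forall y, a y <= N y &
      forall e, 0 < e -> exists2 r, 0 < r &
        forall h, `|h| < r -> phi (x + h) <= phi x + a h + e * `|h| ].
  (* The zero function is a default for [eta <= 0], where nothing is claimed. *)
  have [eta0|] := ltP 0 eta; last by exists (fun=> 0).
  by have [phi phiP] := smooth_approximation eN K0 NK d_dense eta0; exists phi.
have [phi phiP] := choice smooth.
have phiB eta x : 0 < eta -> N x - eta <= phi eta x <= N x.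
  by move=> /phiP[].
have phi_le eta x : 0 < eta -> phi eta x <= N x by move=> /(phiB eta x)/andP[].
have phi_lip eta x h : 0 < eta -> phi eta (x + h) - phi eta x <= N h.
  by move=> /phiP[].
have [s [c [eta [z [x_ [[s0 c0 eta0 sc] [Dz zz0 gz] xz gP]]]]]] :=
  variational_principle eN cplE cD cg g_ge0 phiB phi_lip Dz0 sigma0 lambda0 rho0 gz0.
have d0 k : 0 < 2^-1 ^+ k :> R by rewrite exprn_gt0// invr_gt0.
have [_ _ /(_ (z - z0))[a0 a0N a0P]] := phiP _ eta0.
have /choice[a_ a_P] k : exists a : dual E, (forall y, a y <= N y) /\
    forall e, 0 < e -> exists2 r, 0 < r & forall h, `|h| < r ->
      phi (2^-1 ^+ k) (z - x_ k + h) <= phi (2^-1 ^+ k) (z - x_ k) + a h + e * `|h|.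
  by have [_ _ /(_ (z - x_ k))[a aN aP]] := phiP _ (d0 k); exists a.
pose G k := gradient phi s c x_ z a_ a0 k.
have GN k y : G k y <= (s + 10 * c) * N y.
  by apply: gradient_le => // j x; have [] := a_P j.
exists z, (fun k => - G k); split => // [k y|e e0].
  rewrite -[(- G k) y]/(- G k y) -linearN (le_trans (GN _ _))// (seminormN y sN).
  by rewrite ler_wpM2r ?seminorm_ge0.
have [k0 hk0] : exists k0, 18 * c * 2^-1 ^+ k0 * K < e / 2.
  have ec0 : 0 < e / 2 / (18 * c * K) by rewrite !divr_gt0// !mulr_gt0.
  have [k0 /(_ k0 (leqnn k0)) h] := half_power_lt ec0; exists k0.
  by move: h; rewrite ltr_pdivlMr ?mulr_gt0// mulrC mulrAC.
have [r r0 hr] := gradient_diff sN s0 c0 phi_le phi_lip xz a0P (fun k => (a_P k).2) k0 K0 NK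
  (divr_gt0 e0 (ltr0n _ 2)).
exists (Num.min r K^-1); first by rewrite lt_min r0 invr_gt0.
exists k0 => k u k0k Du; rewrite lt_min => /andP[/hr ur uK].
have Nu1 : N (u - z) <= 1.
  by rewrite (le_trans (NK _))// ltW// -ltr_pdivlMl// mulr1.
have h1 := variational_limit sN c0 phi_le phi_lip xz gP k0 Du Nu1.
have := gradient_tail s sN c0 phi_le xz a0 (fun k => (a_P k).1) (u - z) k0k.
rewrite -/(G k0) -/(G k) ler_norml => /andP[h2 _].
move: ur; rewrite subrKC => ur.
have h3 : c * 2^-1 ^+ k * N (u - z) >= 0.
  by apply: mulr_ge0; [rewrite ltW// mulr_gt0|exact: seminorm_ge0].
have h4 : 18 * c * 2^-1 ^+ k0 * N (u - z) <= e / 2 * `|u - z|.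
  apply: (@le_trans _ _ (18 * c * 2^-1 ^+ k0 * K * `|u - z|)).
    by rewrite -[leRHS]mulrA ler_wpM2l// ltW// !mulr_gt0.
  by rewrite ler_wpM2r// ltW.
rewrite -[(- G k) (u - z)]/(- G k (u - z)).
exact: gradient_estimate h1 ur h2 h3 h4.
Qed.

End variational_consequences.

(** * Separable reduction *)

Section fuzzy_subgradients.
Context {R : realType} {E : normedModType R}.
Variables (N : E -> R) (g : E -> R).
Implicit Types (A : set E) (s : seq (nat * nat * E)) (z w : E).

Definition slopes s w r := \sum_(q <- s) (g q.2 - r + `|q.2 - w| / q.1.1.+1%:R).
Definition steps s w := \sum_(q <- s) (q.2 - w).

(* [(n, m, u)] stands for the point [u], used at precision [1 / (n + 1)] and
   required to lie within [rad / (m + 1)] of [z].  By the Hahn-Banach theorem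
   the inequality below is what a Frechet subgradient bounded by [N] with
   modulus [delta] leaves when only finitely many points are inspected. *)
Definition fuzzy A (rad : R) z (delta : nat -> nat) := forall s,
  (forall q, q \in s ->
    [/\ A q.2, q.1.2 = delta q.1.1 & `|q.2 - z| < rad / q.1.2.+1%:R]) ->
  0 <= slopes s z (g z) + N (steps s z).

(** A list has finitely many thresholds, so some [k] exceeds them all; adding the estimates gives
    [b k (steps s z) <= slopes], while [- N (steps s z) <= b k (steps s z)]. *)
Lemma fuzzy_of_dual A z (b : nat -> dual E) : seminorm N ->
  (forall k y, b k y <= N y) ->
  (forall e, 0 < e -> exists2 r, 0 < r & exists k0, forall k u, (k0 <= k)%N ->
    A u -> `|u - z| < r -> b k (u - z) <= g u - g z + e * `|u - z|) ->
  exists delta, fuzzy A 1 z delta.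
Proof.
move=> sN bN bP.
have /choice[dk dkP] (n : nat) : exists dk : nat * nat, forall k u, (dk.2 <= k)%N ->
    A u -> `|u - z| < 1 / dk.1.+1%:R -> b k (u - z) <= g u - g z + `|u - z| / n.+1%:R.
  have n0 : 0 < n.+1%:R^-1 :> R by rewrite invr_gt0.
  have [r r0 [k0 hk]] := bP _ n0.
  have [m mr] : exists m, 1 / m.+1%:R < r.
    have [m hm] := ltr_add_invr r0; exists m; move: hm; rewrite add0r div1r//.
  exists (m, k0) => k u /= k0k Au uz; rewrite [_ / _]mulrC; apply: hk => //.
  exact: lt_trans uz mr.
exists (fun n => (dk n).1) => s sP.
have [k kP] : exists k, forall q, q \in s -> ((dk q.1.1).2 <= k)%N.
  elim: s {sP} => [|q s [k kP]]; first by exists 0%N.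
  exists (maxn (dk q.1.1).2 k) => q'; rewrite inE => /predU1P[->|/kP h].
    exact: leq_maxl.
  by rewrite (leq_trans h)// leq_maxr.
have : b k (steps s z) <= slopes s z (g z).
  rewrite /steps /slopes linear_sum !big_seq ler_sum// => q qs.
  have [Aq qd qz] := sP _ qs; apply: dkP => //; first exact: kP.
  by rewrite -qd.
have := bN k (- steps s z); rewrite linearN seminormN//; lra.
Qed.

(** Concatenating lists gives sums and natural multiples only, whereas the sandwich wants a cone
    over the reals. [T] therefore consists of the pairs all of whose natural multiples are followed
    by lists up to an error [B] independent of the multiple. *)
Lemma dual_of_fuzzy A rad z delta : equivalent_norm N -> fuzzy A rad z delta ->
  exists2 a : dual E, forall y, a y <= N y & forall n u, A u ->
    `|u - z| < rad / (delta n).+1%:R -> a (u - z) <= g u - g z + `|u - z| / n.+1%:R.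
Proof.
move=> eN fz; have sN : seminorm N by case: eN.
pose adm s := forall q, q \in s ->
  [/\ A q.2, q.1.2 = delta q.1.1 & `|q.2 - z| < rad / q.1.2.+1%:R].
pose approx (wr : E * R) B (m : nat) := exists s, [/\ adm s,
  `|slopes s z (g z) - m%:R * wr.2| <= B & N (steps s z - m%:R *: wr.1) <= B].
pose T : set (E * R) := [set wr | exists B, forall m, approx wr B m].
have T0 : T (0, 0).
  exists 0 => m; exists [::]; split => //=.
    by rewrite /slopes big_nil mulr0 subr0 normr0.
  by rewrite /steps big_nil scaler0 subr0 seminorm0.
have [||||a aN aT] := @sandwich_dual R E N T eN.
- by exists (0, 0).
- move=> w r w' r' [B BP] [B' B'P]; exists (B + B') => m.
  have [s [sP s1 s2]] := BP m; have [s' [s'P s'1 s'2]] := B'P m.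
  exists (s ++ s'); split => [q| |].
  + by rewrite mem_cat => /orP[/sP|/s'P].
  + rewrite /slopes big_cat/= mulrDr opprD addrACA.
    exact: le_trans (ler_normD _ _) (lerD s1 s'1).
  + rewrite /steps big_cat/= scalerDr opprD addrACA.
    exact: le_trans (sN.1 _ _) (lerD s2 s'2).
- move=> t w r t0 [B BP]; exists (B + `|r| + N w) => m.
  (* Rounding [m * t] down to [j] changes the target by at most one copy of [(w, r)], hence the
     increase of the bound by [|r| + N w]. *)
  pose j := Num.truncn (m%:R * t).
  have [s [sP /= s1 s2]] := BP j.
  have jt : `|j%:R - m%:R * t| <= 1.
    have /andP[h1 h2] : j%:R <= m%:R * t < j.+1%:R.
      by apply: truncn_itv; rewrite mulr_ge0// ltW.
    by rewrite distrC ger0_norm ?subr_ge0// lerBlDl natr1 ltW.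
  have Nw := seminorm_ge0 w sN.
  exists s; split => //=.
    have -> : slopes s z (g z) - m%:R * (t * r) =
      (slopes s z (g z) - j%:R * r) + (j%:R - m%:R * t) * r by ring.
    rewrite (le_trans (ler_normD _ _))// normrM.
    by have := ler_wpM2r (normr_ge0 r) jt; lra.
  have -> : steps s z - m%:R *: (t *: w) =
      (steps s z - j%:R *: w) + (j%:R - m%:R * t) *: w.
    by rewrite scalerBl scalerA addrA subrK.
  rewrite (le_trans (sN.1 _ _))// sN.2.
  by have := ler_wpM2r Nw jt; have := normr_ge0 r; lra.
- move=> w r [B BP]; rewrite leNgt; apply/negP => rw0.
  (* The tests give [- 2 * B <= m * (r + N w)] for every [m], which fails for large [m] if
     [r + N w < 0]. *)
  have [m hm] : exists m : nat, 2 * B < m%:R * - (r + N w).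
    have := archi_boundP (normr_ge0 (2 * B / - (r + N w))).
    set m := Num.bound _ => h; exists m.
    by rewrite -ltr_pdivrMr ?oppr_gt0// (le_lt_trans (ler_norm _)).
  have [s [sP /= s1 s2]] := BP m.
  have := fz s sP.
  have := sN.1 (steps s z - m%:R *: w) (m%:R *: w); rewrite subrK sN.2 normr_nat.
  move: s1; rewrite ler_norml => /andP[_ s1]; lra.
exists a => // n u Au uz; apply: aT; exists 0 => m.
exists (nseq m (n, delta n, u)); split => [q| |] /=.
- by move=> /nseqP[-> _].
- by rewrite /slopes big_nseq iter_addr_0 mulr_natl subrr normr0.
- by rewrite /steps big_nseq iter_addr_0 scaler_nat subrr seminorm0.
Qed.

Lemma slopes_shift s w r r' : slopes s w r = slopes s w r' + (size s)%:R * (r' - r).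
Proof.
rewrite /slopes; elim: s => [|q s IH]; first by rewrite !big_nil mul0r addr0.
by rewrite !big_cons IH/= -natr1; ring.
Qed.

Lemma steps_shift s w z : steps s w = steps s z + (size s)%:R *: (z - w).
Proof.
rewrite /steps; elim: s => [|q s IH]; first by rewrite !big_nil scale0r addr0.
rewrite !big_cons IH/= -natr1 scalerDl scale1r -[q.2 - w](subrKA z) addrACA.
by rewrite [z - w + _]addrC.
Qed.

Lemma slopes_move s z w r : slopes s w r <= slopes s z r + (size s)%:R * `|w - z|.
Proof.
rewrite /slopes; elim: s => [|q s IH]; first by rewrite !big_nil mul0r addr0.
rewrite !big_cons/= -[(size s).+1%:R]natr1.
have : `|q.2 - w| / q.1.1.+1%:R <= `|q.2 - z| / q.1.1.+1%:R + `|w - z|.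
  rewrite ler_pdivrMr// mulrDl divfK// [`|w - z|]distrC.
  have -> : q.2 - w = (q.2 - z) + (z - w) by rewrite addrA subrK.
  by rewrite (le_trans (ler_normD _ _))// lerD2l ler_peMr// ler1n.
move: IH; rewrite mulrDl mul1r.
move: (\sum_(_ <- s) _) (\sum_(_ <- s) _) => s1 s2.
move: (`|q.2 - w| / _) (`|q.2 - z| / _) => *; lra.
Qed.

Lemma value_move (K : R) s z w r : seminorm N -> (forall x, N x <= K * `|x|) ->
  slopes s w r + N (steps s w) <=
  slopes s z r + N (steps s z) + (size s)%:R * ((K + 1) * `|w - z|).
Proof.
move=> sN NK; have h1 := slopes_move s z w r.
have h2 : N (steps s w) <= N (steps s z) + (size s)%:R * (K * `|w - z|).
  rewrite (steps_shift _ _ z) (le_trans (sN.1 _ _))// lerD2l sN.2 normr_nat.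
  by rewrite ler_wpM2l// distrC.
rewrite mulrDl mul1r mulrDr; lra.
Qed.

End fuzzy_subgradients.

Lemma closure_normP {R : realType} {E : normedModType R} (A : set E) (x : E) :
  closure A x <-> forall e, 0 < e -> exists2 y, A y & `|x - y| < e.
Proof.
split=> [Ax e e0|h B /nbhs_ballP[e /= e0 eB]].
  have [y [Ay xy]] := Ax _ (nbhsx_ballx x e e0).
  by exists y => //; rewrite -ball_normE in xy.
have [y Ay xy] := h e e0; exists y; split => //.
by apply: eB; rewrite -ball_normE.
Qed.

(** The hull is the set of values of a countable type of terms: one child means the operation coded
    by the label, two or more children the sum of the first two, anything else [z0]. *)
Lemma countable_hull (Z : zmodType) (K : countType) (op : K -> Z -> Z) (z0 : Z) :
  exists C : set Z, [/\ countable C, C z0, forall x y, C x -> C y -> C (x + y) &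
    forall k x, C x -> C (op k x)].
Proof.
pose eval := fix eval (t : GenTree.tree unit) : Z := match t with
  | GenTree.Node n [:: t1] => if unpickle n is Some k then op k (eval t1) else z0
  | GenTree.Node _ [:: t1, t2 & _] => eval t1 + eval t2
  | _ => z0
  end.
exists (range eval); split.
- exact: sub_countable (card_image_le _ _) (countableP _).
- by exists (GenTree.Leaf tt).
- by move=> _ _ [t1 _ <-] [t2 _ <-]; exists (GenTree.Node 0 [:: t1; t2]).
- by move=> k _ [t _ <-]; exists (GenTree.Node (pickle k) [:: t]) => //=; rewrite pickleK.
Qed.

Lemma add_quarters (R : realFieldType) (a b x : R) :
  a < 4^-1 * x -> b < 4^-1 * x -> a + b < 2^-1 * x.
Proof. lra. Qed.

Lemma add_half_quarter (R : realFieldType) (a b x : R) :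
  0 <= b -> a < 2^-1 * x -> b < 4^-1 * x -> a + b < 1 * x.
Proof. lra. Qed.

Section separable_reduction.
Context {R : realType} {Z : normedModType R}.
Variables (N : Z -> R) (g : Z -> R) (D : set Z) (K : countType) (op : K -> Z -> Z).
Hypothesis eN : equivalent_norm N.

Let value s (w : Z) r := slopes g s w r + N (steps s w).
Let code := seq (nat * nat).

Let witness (c : code) (r : rat) (w : Z) (s : seq (nat * nat * Z)) :=
  [/\ map fst s = c, forall q, q \in s -> D q.2 /\ `|q.2 - w| < 2^-1 / q.1.2.+1%:R &
    value s w (ratr r) < 0].

(** There are uncountably many [z] and [delta], but a violating list involves only finitely many
    integers, a point and a reference value. The last two are approximated by a point [w] of [C] and
    a rational, so countably many chosen violations suffice, and [C] contains them. The radii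
    [4^-1], [2^-1] and [1] leave room for moving from [z] to [w] and back. *)
Lemma separable_reduction (z0 : Z) : exists C : set Z, [/\ countable C, C z0,
  forall x y, C x -> C y -> C (x + y), forall k x, C x -> C (op k x) &
  forall z delta, closure C z -> fuzzy N g (D `&` C) 1 z delta -> fuzzy N g D 4^-1 z delta].
Proof.
have [sN _ [M M0 NM]] := eN.
have /choice[W WP] (a : code * rat * Z) : exists s,
    (exists s', witness a.1.1 a.1.2 a.2 s') -> witness a.1.1 a.1.2 a.2 s.
  by have [[s' s'P]|h] := pselect (exists s', witness a.1.1 a.1.2 a.2 s');
    [exists s'|exists [::]].
(* Closing under the [i]-th point of the list chosen for [(c, r, z)], for every [i], puts the whole
   list into [C]. *)
pose op' (k : K + code * rat * nat) (z : Z) : Z := match k with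
  | inl k => op k z
  | inr (c, r, i) => (nth (0%N, 0%N, 0) (W (c, r, z)) i).2
  end.
have [C [cC Cz0 CD Cop]] := countable_hull op' z0.
exists C; split => // [k x|]; first exact: (Cop (inl k)).
have CW c r w : C w -> forall q, q \in W (c, r, w) -> C q.2.
  by move=> Cw q qW; have := Cop (inr (c, r, index q (W (c, r, w)))) _ Cw; rewrite /= nth_index.
move=> z delta Cz fz s sP; rewrite leNgt; apply/negP => s0.
pose l := (size s)%:R : R.
have l0 : 0 <= l by [].
(* Three units [l * kap] are spent on the way to [w]: two for lowering the reference value, one for
   moving the point. [l + 1] keeps the denominator positive. *)
pose kap := - value s z (g z) / (4 * (l + 1)).
have kap0 : 0 < kap by rewrite divr_gt0 ?oppr_gt0// mulr_gt0// ltr_wpDl.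
have lkap : 4 * (l * kap) < - value s z (g z).
  have : kap * (4 * (l + 1)) = - value s z (g z) by rewrite divfK// gt_eqF// mulr_gt0// ltr_wpDl.
  by rewrite /value in s0 *; move: kap0; lra.
have [m mP] : exists m, forall q, q \in s -> (q.1.2 <= m)%N.
  elim: (s) => [|q s' [m mP]]; first by exists 0%N.
  exists (maxn q.1.2 m) => q'; rewrite inE => /predU1P[->|/mP h]; first exact: leq_maxl.
  by rewrite (leq_trans h)// leq_maxr.
have M10 : 0 < M + 1 by rewrite addr_gt0.
(* [r] is below [g z] by at least [kap]: raising the reference value back to [g z] then lowers the
   slopes by at least [l * kap], which pays for the return from [w] to [z]. *)
have [r] : exists r : rat, ratr r \in `](g z - 2 * kap), (g z - kap)[.
  by apply: rat_in_itvoo; move: kap0; lra.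
rewrite in_itv/= => /andP[r1 r2].
have [w Cw] : exists2 w, C w & `|z - w| < Num.min (4^-1 / m.+1%:R) (kap / (M + 1)).
  have /closure_normP := Cz; apply; rewrite lt_min (divr_gt0 kap0 M10) andbT.
  by rewrite divr_gt0// invr_gt0.
rewrite lt_min => /andP[w1 w2].
have {}w2 : (M + 1) * `|z - w| <= kap by rewrite mulrC -ler_pdivlMr// ltW.
have wit : witness (map fst s) r w (W (map fst s, r, w)).
  apply: (WP (map fst s, r, w)); exists s; split => // [q qs|].
    have [Dq _ qz] := sP _ qs; split => //.
    have h : 4^-1 / m.+1%:R <= 4^-1 / q.1.2.+1%:R :> R.
      by rewrite ler_pM2l// lef_pV2 ?posrE// ler_nat ltnS mP.
    have -> : q.2 - w = (q.2 - z) + (z - w) by rewrite addrA subrK.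
    by apply: le_lt_trans (ler_normD _ _) _; exact: add_quarters qz (lt_le_trans w1 h).
  have := value_move g s z w (ratr r) sN NM; rewrite -/l distrC /value in lkap *.
  have := slopes_shift g s z (ratr r) (g z); rewrite -/l.
  have : l * (g z - ratr r) <= l * (2 * kap) by rewrite ler_wpM2l//; lra.
  have := ler_wpM2l l0 w2; move: s0; lra.
move: wit; set s' := W _ => -[s's s'P s'0].
have ss' : size s' = size s by rewrite -(size_map fst s') s's size_map.
have : 0 <= value s' z (g z).
  apply: fz => q qs'.
  have [Dq qw] := s'P _ qs'.
  have [q' q's q'E] : exists2 q', q' \in s & q'.1 = q.1.
    have : q.1 \in map fst s by rewrite -s's map_f.
    by move=> /mapP[q' ? ->]; exists q'.
  have [_ qd _] := sP _ q's; rewrite q'E in qd; split => //.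
    by split => //; apply: CW qs'.
  have h : 4^-1 / m.+1%:R <= 4^-1 / q.1.2.+1%:R :> R.
    by rewrite ler_pM2l// lef_pV2 ?posrE// ler_nat ltnS -q'E mP.
  have -> : q.2 - z = (q.2 - w) + (w - z) by rewrite addrA subrK.
  apply: le_lt_trans (ler_normD _ _) _; rewrite [`|w - z|]distrC.
  exact: add_half_quarter (normr_ge0 _) qw (lt_le_trans w1 h).
have := value_move g s' w z (g z) sN NM; rewrite ss' -/l.
have := slopes_shift g s' w (g z) (ratr r); rewrite ss' -/l.
have : l * (ratr r - g z) <= l * - kap by rewrite ler_wpM2l//; lra.
have := ler_wpM2l l0 w2; move: s'0; rewrite /value; lra.
Qed.

End separable_reduction.

(** * Completeness, separable subspaces and their duals *)

Lemma complete_seq_complete {R : realType} (X : completeNormedModType R) :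
  @seq_complete R X.
Proof.
move=> u uC; apply/cvg_ex; apply: cauchy_cvg; apply/cauchyP => e e0.
have [k hk] := uC e e0; exists (u k); exists k => // j /= kj.
by rewrite -ball_normE/= distrC; exact: hk.
Qed.

Lemma prod_seq_complete {R : realType} (X Y : normedModType R) :
  @seq_complete R X -> @seq_complete R Y -> @seq_complete R (X * Y)%type.
Proof.
move=> cX cY u uC.
have [x ux] : exists x : X, (fun k => (u k).1) @ \oo --> x.
  apply: cX => e /uC[k hk]; exists k => j /hk; apply: le_lt_trans.
  by rewrite -[(u j).1 - (u k).1]/((u j - u k).1) prod_normE le_max lexx.
have [y uy] : exists y : Y, (fun k => (u k).2) @ \oo --> y.
  apply: cY => e /uC[k hk]; exists k => j /hk; apply: le_lt_trans.
  by rewrite -[(u j).2 - (u k).2]/((u j - u k).2) prod_normE le_max lexx orbT.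
exists (x, y); have := cvg_pair ux uy.
have -> : (fun k => ((u k).1, (u k).2)) = u.
  by apply/funext => k; case: (u k).
exact.
Qed.

Lemma equivalent_normZ {R : realType} (E : normedModType R) (N : E -> R) (s : R) :
  0 < s -> equivalent_norm N -> equivalent_norm (fun x => s * N x).
Proof.
move=> s0 [[ND NZ] [c c0 cN] [K K0 NK]]; split.
- by split=> [x y|t x]; [rewrite -mulrDr ler_pM2l|rewrite NZ mulrCA].
- by exists (s * c) => [|x]; [exact: mulr_gt0|rewrite -mulrA ler_pM2l].
- by exists (s * K) => [|x]; [exact: mulr_gt0|rewrite -mulrA ler_pM2l].
Qed.

Section weighted_max_norm.
Context {R : realType} {X Y : normedModType R}.
Variable gamma : R.
Hypothesis gamma0 : 0 < gamma.

(** The norm on the product to which the norm behind [dist_gamma] is dual. *)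
Definition weighted_max (w : X * Y) : R := Num.max `|w.1| (gamma * `|w.2|).

Lemma weighted_max_equivalent : @equivalent_norm R (X * Y)%type weighted_max.
Proof.
split.
- split=> [[x y] [x' y']|t [x y]] /=.
    rewrite /weighted_max/= ge_max; apply/andP; split.
      by rewrite (le_trans (ler_normD _ _))// lerD// le_max lexx.
    apply: (@le_trans _ _ (gamma * `|y| + gamma * `|y'|)).
      by rewrite -mulrDr ler_pM2l// ler_normD.
    by rewrite lerD// le_max lexx orbT.
  by rewrite /weighted_max/= !normrZ maxr_pMr// mulrCA.
- exists (Num.min 1 gamma) => [|[x y]]; first by rewrite lt_min ltr01.
  rewrite prod_normE maxr_pMr/=; last by rewrite le_min ler01 ltW.
  rewrite /weighted_max/= ge_max; apply/andP; split; rewrite le_max.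
    by rewrite ler_piMl// ge_min lexx.
  by rewrite [X in _ || X]ler_wpM2r ?orbT// ge_min lexx orbT.
- exists (1 + gamma) => [|[x y]]; first by rewrite addr_gt0.
  rewrite prod_normE /weighted_max/= ge_max; apply/andP; split.
    apply: (@le_trans _ _ (Num.max `|x| `|y|)); first by rewrite le_max lexx.
    by apply: ler_peMl; [rewrite le_max normr_ge0|rewrite lerDl ltW].
  apply: ler_pM => //; first exact: ltW.
    by rewrite lerDr.
  by rewrite le_max lexx orbT.
Qed.

End weighted_max_norm.

Section separability.
Context {R : realType}.

Lemma dense_normP (V : normedModType R) (A : set V) :
  dense A <-> forall x e, 0 < e -> exists2 y, A y & `|x - y| < e.
Proof.
split=> [dA x e e0|h O [x Ox] oO].
  have [||y [xy Ay]] := dA (ball x e).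
  - by exists x; exact: ballxx.
  - exact: ball_open.
  - by exists y => //; rewrite -ball_normE in xy.
have : nbhs x O by apply: open_nbhs_nbhs.
move=> /nbhs_ballP[e /= e0 eO]; have [y Ay xy] := h x e e0.
by exists y; split => //; apply: eO; rewrite -ball_normE.
Qed.

Lemma separable_seq (V : normedModType R) : separable V ->
  exists d : nat -> V, forall x e, 0 < e -> exists n, `|x - d n| < e.
Proof.
move=> [A /countable_injP[f finj] /dense_normP dA].
have /choice[d dP] n : exists y, (exists2 a, A a & f a = n) -> A y /\ f y = n.
  by have [[a Aa fa]|h] := pselect (exists2 a, A a & f a = n); [exists a|exists 0].
exists d => x e /(dA x)[y Ay xy]; exists (f y).
have [|Ad fd] := dP (f y); first by exists y.
by rewrite (finj (d (f y)) y) ?inE.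
Qed.

Lemma seq_separable (V : normedModType R) (I : countType) (d : I -> V) :
  (forall x e, 0 < e -> exists n, `|x - d n| < e) -> separable V.
Proof.
move=> h; exists (range d).
  exact: sub_countable (card_image_le _ _) (countableP _).
by apply/dense_normP => x e /(h x)[n xn]; exists (d n) => //; exists n.
Qed.

End separability.

Section isometries.
Context {R : realType} {E V : normedModType R} (j : E -> V).
Hypothesis jB : forall x y, `|j x - j y| = `|x - y|.

Lemma isometry_continuous : continuous j.
Proof.
move=> x; apply/cvgrPdist_lt => e e0; near=> y; rewrite jB; near: y.
exact: cvgr_dist_lt.
Unshelve. all: by end_near. Qed.

Lemma isometry_seq_complete : closed (range j) -> @seq_complete R V -> @seq_complete R E.
Proof.
move=> cj cV u uC.
have [|l ul] := cV (j \o u).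
  by move=> e /uC[k hk]; exists k => i /hk /=; rewrite jB.
have [l' _ jl'] : range j l.
  apply: (@closed_cvg _ _ _ _ _ (range j) cj _ _ ul).
  by apply: nearW => k; exists (u k).
exists l'; apply/cvgrPdist_lt => e e0.
have /cvgrPdist_lt/(_ e e0) := ul.
by apply: filterS => k /=; rewrite -jl' jB.
Qed.

Lemma isometry_separable (C : set V) : countable C -> C `<=` range j ->
  range j `<=` closure C -> separable E.
Proof.
move=> cC Cj jC; exists (j @^-1` C).
  apply: sub_countable (card_ge_preimage _) cC => x y _ _ jxy.
  by apply/eqP; rewrite -subr_eq0 -normr_eq0 -jB jxy subrr normr0.
apply/dense_normP => x e e0.
have /closure_normP/(_ e e0)[c Cc xc] : closure C (j x) by apply: jC; exists x.
by have [y _ jy] := Cj _ Cc; exists y; rewrite /preimage/= ?jy// -jB jy.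
Qed.

End isometries.

Section subspaces.
Context {R : realType} {V : normedModType R}.

(** [C] is stable under rational scalars only. The rational replacing [a] is picked after [x'],
    since the resulting error scales with the size of [x']. *)
Lemma closure_submodClosed (C : set V) (z0 : V) : C z0 ->
  (forall x y, C x -> C y -> C (x + y)) ->
  (forall (q : rat) x, C x -> C (ratr q *: x)) ->
  exists M : submodClosed V, forall x, x \in M <-> closure C x.
Proof.
move=> Cz0 CD CZ; pose P : {pred V} := fun x => `[< closure C x >].
suff PS : submod_closed P.
  pose M : submodClosed V := HB.pack P (GRing.isSubmodClosed.Build R V P PS).
  exists M => x.
  by split=> [/asboolP|?]//; exact/asboolP.
split.
  apply/asboolP/subset_closure.
  by have := CZ 0 _ Cz0; rewrite rmorph0 scale0r.
move=> a x y /asboolP/closure_normP Cx /asboolP/closure_normP Cy.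
apply/asboolP/closure_normP => e e0.
have e30 : 0 < e / 3 by rewrite divr_gt0.
have a10 : 0 < `|a| + 1 by rewrite ltr_wpDl.
have [x' Cx' xx'] := Cx _ (divr_gt0 e30 a10).
have x'10 : 0 < `|x'| + 1 by rewrite ltr_wpDl.
have [y' Cy' yy'] := Cy _ e30.
have [q] : exists q : rat, ratr q \in `](a - e / 3 / (`|x'| + 1)), a[.
  by apply: rat_in_itvoo; rewrite gtrBl divr_gt0.
rewrite in_itv/= => /andP[q1 q2].
exists (ratr q *: x' + y'); first by apply: CD => //; exact: CZ.
have -> : a *: x + y - (ratr q *: x' + y') =
    (a *: (x - x') + (a - ratr q) *: x') + (y - y').
  by rewrite scalerBr scalerBl subrKA opprD addrACA.
have h1 : `|a| * `|x - x'| <= e / 3.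
  apply: (@le_trans _ _ ((`|a| + 1) * `|x - x'|)); first by rewrite ler_wpM2r// lerDl.
  by rewrite -ler_pdivlMl// mulrC ltW.
have h2 : `|a - ratr q| * `|x'| <= e / 3.
  apply: (@le_trans _ _ (`|a - ratr q| * (`|x'| + 1))); first by rewrite ler_wpM2l// lerDl.
  rewrite -ler_pdivlMr// ger0_norm ?subr_ge0 ?(ltW q2)//.
  by rewrite lerBlDr -lerBlDl ltW.
apply: le_lt_trans (ler_normD _ _) _; apply: le_lt_trans (lerD (ler_normD _ _) (lexx _)) _.
rewrite !normrZ; lra.
Qed.

End subspaces.

Section dual_decomposition.
Context {R : realType}.

Lemma dual_pullback (E F : normedModType R) (j : E -> F) (f : dual F) : linear j ->
  (forall x, `|j x| <= `|x|) -> exists h : dual E, forall x, h x = f (j x).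
Proof.
move=> lj jle; suff ac : (f \o j) \in @continuous_linear R E by exists (Dual ac).
rewrite inE; split; first by move=> a x y /=; rewrite lj linearP.
have jB x y : j (x - y) = j x - j y by rewrite -scaleN1r addrC lj scaleN1r addrC.
move=> x; apply: continuous_comp; last exact: dual_continuous.
apply/cvgrPdist_lt => e e0; near=> y; rewrite -jB.
by apply: le_lt_trans (jle _) _; near: y; exact: cvgr_dist_lt.
Unshelve. all: by end_near. Qed.

Variables (E E1 E2 : normedModType R).
Variables (p1 : E -> E1) (p2 : E -> E2) (i1 : E1 -> E) (i2 : E2 -> E).
Hypotheses (lp1 : linear p1) (lp2 : linear p2) (li1 : linear i1) (li2 : linear i2).
Hypotheses (p1_le : forall x, `|p1 x| <= `|x|) (p2_le : forall x, `|p2 x| <= `|x|).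
Hypotheses (i1_le : forall x, `|i1 x| <= `|x|) (i2_le : forall x, `|i2 x| <= `|x|).
Hypothesis ipD : forall x, i1 (p1 x) + i2 (p2 x) = x.

(** Each functional [f] splits as [f \o i1 \o p1 + f \o i2 \o p2], and the two parts are
    approximated separately. *)
Lemma dual_separable_sum : separable (dual E1) -> separable (dual E2) -> separable (dual E).
Proof.
move=> /separable_seq[d1 d1P] /separable_seq[d2 d2P].
have /choice[d dP] (n : nat * nat) : exists h : dual E,
    forall x, h x = d1 n.1 (p1 x) + d2 n.2 (p2 x).
  have [h1 h1P] := dual_pullback (d1 n.1) lp1 p1_le.
  have [h2 h2P] := dual_pullback (d2 n.2) lp2 p2_le.
  by exists (h1 + h2) => x; rewrite dualD h1P h2P.
apply: (seq_separable (d := d)) => f e e0.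
have [f1 f1P] := dual_pullback f li1 i1_le.
have [f2 f2P] := dual_pullback f li2 i2_le.
have e30 : 0 < e / 3 by rewrite divr_gt0.
have [n1 hn1] := d1P f1 _ e30; have [n2 hn2] := d2P f2 _ e30.
exists (n1, n2); apply: (@le_lt_trans _ _ (2 * (e / 3))); last by lra.
apply: dual_norm_le_of => [|x]; first by rewrite mulr_ge0// ltW.
have -> : (f - d (n1, n2)) x = (f1 - d1 n1) (p1 x) + (f2 - d2 n2) (p2 x).
  rewrite !dualD -[(- d (n1, n2)) x]/(- d (n1, n2) x) -[(- d1 n1) _]/(- d1 n1 _).
  rewrite -[(- d2 n2) _]/(- d2 n2 _) dP f1P f2P addrACA -linearD ipD opprD//.
rewrite [2 * (e / 3)]mulr_natl mulr2n mulrDl.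
have bound (F : normedModType R) (h : dual F) (y : F) (x' : E) :
    `|h| < e / 3 -> `|y| <= `|x'| -> h y <= e / 3 * `|x'|.
  by move=> /ltW hh yx; rewrite (le_trans (dual_le _ _))// ler_pM.
by rewrite lerD// bound.
Qed.

End dual_decomposition.

(** A subspace of a product is rarely a product of subspaces. Stability of [C] under both coordinate
    projections makes its closure the sum of the closures of its two slices, to which the Asplund
    hypotheses on [X] and [Y] apply separately. *)
Lemma asplund_hull {R : realType} (X Y : normedModType R) (C : set (X * Y)) (z0 : X * Y) :
  asplund X -> asplund Y -> countable C -> C z0 ->
  (forall x y, C x -> C y -> C (x + y)) -> (forall (q : rat) x, C x -> C (ratr q *: x)) ->
  (forall w, C w -> C (w.1, 0)) -> (forall w, C w -> C (0, w.2)) ->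
  exists (E : normedModType R) (j : E -> X * Y), [/\ linear j,
    forall x, `|j x| = `|x|, range j = closure C & separable (dual E)].
Proof.
move=> aX aY cC Cz0 CD CZ Cp1 Cp2.
have [M MP] := closure_submodClosed Cz0 CD CZ.
pose C1 : set X := [set x | C (x, 0)].
pose C2 : set Y := [set y | C (0, y)].
have [M1 M1P] : exists M1 : submodClosed X, forall x, x \in M1 <-> closure C1 x.
  apply: (@closure_submodClosed _ _ C1 z0.1) => [|x y|q x]; rewrite /C1/=; first exact: Cp1.
    by move=> h1 h2; have := CD _ _ h1 h2; rewrite -[(_, _) + _]/(_ + _, _ + _) addr0.
  by move=> /(CZ q); rewrite -[_ *: (_, _)]/(_ *: _, _ *: _) scaler0.
have [M2 M2P] : exists M2 : submodClosed Y, forall x, x \in M2 <-> closure C2 x.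
  apply: (@closure_submodClosed _ _ C2 z0.2) => [|x y|q x]; rewrite /C2/=; first exact: Cp2.
    by move=> h1 h2; have := CD _ _ h1 h2; rewrite -[(_, _) + _]/(_ + _, _ + _) addr0.
  by move=> /(CZ q); rewrite -[_ *: (_, _)]/(_ *: _, _ *: _) scaler0.
have norm_fst (w : X * Y) : `|w.1| <= `|w| by rewrite prod_normE le_max lexx.
have norm_snd (w : X * Y) : `|w.2| <= `|w| by rewrite prod_normE le_max lexx orbT.
have normx0 (x : X) : `|(x, 0 : Y)| = `|x|.
  by rewrite prod_normE/= normr0; apply/max_idPl.
have norm0y (y : Y) : `|(0 : X, y)| = `|y|.
  by rewrite prod_normE/= normr0; apply/max_idPr.
have sub0 (w w' : X * Y) : w - w' = (w.1 - w'.1, w.2 - w'.2) by case: w w' => ? ? [].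
have pairD (w : X * Y) : (w.1, 0) + (0, w.2) = w.
  by case: w => x y; rewrite -[LHS]/(x + 0, 0 + y) addr0 add0r.
have i1L a (x y : X) : (a *: x + y, 0 : Y) = a *: (x, 0) + (y, 0).
  by rewrite -[RHS]/(a *: x + y, a *: 0 + 0) scaler0 addr0.
have i2L a (x y : Y) : (0 : X, a *: x + y) = a *: (0, x) + (0, y).
  by rewrite -[RHS]/(a *: 0 + 0, a *: x + y) scaler0 addr0.
have p1M w : w \in M -> w.1 \in M1.
  move=> /MP/closure_normP h; apply/M1P/closure_normP => e /h[c Cc wc].
  exists c.1; first exact: Cp1.
  by apply: le_lt_trans wc; rewrite (le_trans _ (norm_fst _)).
have p2M w : w \in M -> w.2 \in M2.
  move=> /MP/closure_normP h; apply/M2P/closure_normP => e /h[c Cc wc].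
  exists c.2; first exact: Cp2.
  by apply: le_lt_trans wc; rewrite (le_trans _ (norm_snd _)).
have i1M x : x \in M1 -> (x, 0) \in M.
  move=> /M1P/closure_normP h; apply/MP/closure_normP => e /h[c Cc xc].
  by exists (c, 0) => //; rewrite sub0/= subrr normx0.
have i2M y : y \in M2 -> (0, y) \in M.
  move=> /M2P/closure_normP h; apply/MP/closure_normP => e /h[c Cc yc].
  by exists (0, c) => //; rewrite sub0/= subrr norm0y.
have sepM1 : separable (lin_subspace M1).
  apply: (@isometry_separable R (lin_subspace M1) X (@lin_subspace_val R X M1) _ C1) => //.
  - apply: sub_countable cC; apply: (card_ge_preimage (f := fun x : X => (x, 0 : Y))).
    by move=> x y _ _ [].
  - move=> x C1x; have xM : x \in M1 by apply/M1P; exact: subset_closure.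
    by exists (LinSubspace xM).
  - by move=> _ [x _ <-]; apply/M1P; exact: lin_subspaceP.
have sepM2 : separable (lin_subspace M2).
  apply: (@isometry_separable R (lin_subspace M2) Y (@lin_subspace_val R Y M2) _ C2) => //.
  - apply: sub_countable cC; apply: (card_ge_preimage (f := fun y : Y => (0 : X, y))).
    by move=> x y _ _ [].
  - move=> x C2x; have xM : x \in M2 by apply/M2P; exact: subset_closure.
    by exists (LinSubspace xM).
  - by move=> _ [x _ <-]; apply/M2P; exact: lin_subspaceP.
exists (lin_subspace M), (@lin_subspace_val R _ M); split => //.
- apply/seteqP; split=> [_ [x _ <-]|x /MP xM]; first by apply/MP; exact: lin_subspaceP.
  by exists (LinSubspace xM).
- apply: (@dual_separable_sum R (lin_subspace M) (lin_subspace M1) (lin_subspace M2)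
    (fun w => LinSubspace (p1M _ (lin_subspaceP w)))
    (fun w => LinSubspace (p2M _ (lin_subspaceP w)))
    (fun x => LinSubspace (i1M _ (lin_subspaceP x)))
    (fun y => LinSubspace (i2M _ (lin_subspaceP y)))) => //.
  + by move=> a x y; exact: val_inj.
  + by move=> a x y; exact: val_inj.
  + move=> a x y; apply: val_inj.
    by apply: etrans (i1L a (lin_subspace_val x) (lin_subspace_val y)) _.
  + move=> a x y; apply: val_inj.
    by apply: etrans (i2L a (lin_subspace_val x) (lin_subspace_val y)) _.
  + by move=> x; exact: (norm_fst (lin_subspace_val x)).
  + by move=> x; exact: (norm_snd (lin_subspace_val x)).
  + by move=> x; have /eqP := normx0 (lin_subspace_val x); rewrite eq_le => /andP[].
  + by move=> x; have /eqP := norm0y (lin_subspace_val x); rewrite eq_le => /andP[].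
  + by move=> x; apply: val_inj; exact: (pairD (lin_subspace_val x)).
  + exact: aX.
  + exact: aY.
Qed.

(** * Subgradients at perturbed minimizers *)

Section subdifferential_realization.
Context {R : realType} {Z : normedModType R}.
Variables (N : Z -> R) (g : Z -> R) (D : set Z).
Hypothesis eN : equivalent_norm N.

Let f (w : Z) : \bar R := ((g w)%:E + indicator D w)%E.

Let f_dom w : D w -> f w = (g w)%:E.
Proof. by move=> Dw; rewrite /f /indicator mem_set// adde0. Qed.

Let f_out w : ~ D w -> f w = +oo%E.
Proof. by move=> Dw; rewrite /f /indicator memNset// addey. Qed.

Lemma frechet_subdiff_of_estimate z (a : dual Z) (c : nat -> R) : D z ->
  (forall n, 0 < c n) ->
  (forall n u, D u -> `|u - z| < c n -> a (u - z) <= g u - g z + `|u - z| / n.+1%:R) ->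
  frechet_subdiff f z a.
Proof.
move=> Dz c0 aP; split; first by rewrite f_dom.
rewrite limf_einfE; apply/lee_addgt0Pr => e e0.
have [n hn] : exists n, n.+1%:R^-1 < e.
  by have [n] := ltr_add_invr e0; rewrite add0r; exists n.
rewrite -leeBlDr// sub0e.
apply: (@le_trans _ _ (ereal_inf [set ((f w - f z - (a (w - z))%:E) * (`|w - z|^-1)%:E)%E |
    w in [set w | `|w - z| < c n /\ w != z]])); last first.
  apply: ereal_sup_ubound; exists [set w | `|w - z| < c n /\ w != z] => //.
  rewrite /dnbhs /within/=; apply/nbhs_ballP; exists (c n) => //= w.
  by rewrite -ball_normE/= distrC.
apply: le_ereal_inf_tmp => _ [w [wz wz0] <-].
have wz1 : 0 < `|w - z| by rewrite normr_gt0 subr_eq0.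
rewrite (f_dom Dz); have [Dw|Dw] := pselect (D w); last first.
  by rewrite f_out// -EFinN -EFinN !addye// gt0_mulye ?leey// lte_fin invr_gt0.
rewrite (f_dom Dw) -!EFinB -EFinM lee_fin ler_pdivlMr//.
have := aP n w Dw wz.
have : `|w - z| / n.+1%:R <= e * `|w - z| by rewrite mulrC ler_wpM2r// ltW.
move: (`|w - z|) (`|w - z| / _) (a _) => *; lra.
Qed.

Lemma clarke_tangent0 (V : normedModType R) (A : set V) v : clarke_tangent A v 0.
Proof.
move=> v_ t_ Av _ _ _; exists (fun=> 0); first exact: cvg_cst.
by move=> k; rewrite scaler0 addr0.
Qed.

(** The points [v_ k + t_ k *: w_ k] form another sequence in [A] tending to [v], along which the
    second tangent vector may be tested. This convexity is what the separation argument rests on. *)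
Lemma clarke_tangentD (V : normedModType R) (A : set V) v w w' :
  clarke_tangent A v w -> clarke_tangent A v w' -> clarke_tangent A v (w + w').
Proof.
move=> Tw Tw' v_ t_ Av vv t0 tt.
have [w_ ww wA] := Tw v_ t_ Av vv t0 tt.
have vv' : (fun k => v_ k + t_ k *: w_ k) @ \oo --> v.
  by rewrite -[v in X in _ --> X]addr0 -(scale0r w); apply: cvgD => //; exact: cvgZ.
have [w'_ ww' wA'] := Tw' _ t_ wA vv' t0 tt.
exists (fun k => w_ k + w'_ k); first exact: cvgD.
by move=> k; rewrite scalerDr addrA.
Qed.

Lemma clarke_tangentZ (V : normedModType R) (A : set V) v w t : 0 < t ->
  clarke_tangent A v w -> clarke_tangent A v (t *: w).
Proof.
move=> s0 Tw v_ t_ Av vv t0 tt.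
have [||w_ ww wA] := Tw v_ (fun k => t_ k * t) Av vv.
- by move=> k; rewrite mulr_gt0.
- by rewrite -(mul0r t); apply: cvgMl.
- exists (fun k => t *: w_ k); first exact: cvgZr.
  by move=> k; rewrite scalerA.
Qed.

(* Since [z] minimizes [f + N (. - z)] locally, the tangent cone to the epigraph
   of [f] lies in that of [- N]; a hyperplane separating the two is the
   required subgradient. *)
Lemma clarke_subdiff_of_minimum z rad : D z -> 0 < rad ->
  (forall u, D u -> N (u - z) <= rad -> g z <= g u + N (u - z)) ->
  exists2 a : dual Z, clarke_subdiff f z a & forall y, a y <= N y.
Proof.
move=> Dz rad0 zmin; have [sN _ [K K0 NK]] := eN.
pose T := clarke_tangent (epigraph f) (z, g z).
have [|||w r|a aN aT] := @sandwich_dual R Z N T eN.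
- by exists (0, 0); exact: clarke_tangent0.
- by move=> w r w' r'; exact: clarke_tangentD.
- by move=> t w r; exact: clarke_tangentZ.
(* Along the constant sequence [(z, g z)] tangency yields points of the epigraph, and minimality of
   [z] turns them into [0 <= (w_ k).2 + N (w_ k).1] for large [k]. *)
- move=> Twr; pose t_ (k : nat) : R := k.+1%:R^-1.
  have t0 k : 0 < t_ k by rewrite invr_gt0.
  have [||w_ ww wA] := Twr (fun=> (z, g z)) t_ _ (cvg_cst _) t0.
  + by move=> k; rewrite /epigraph/= f_dom.
  + exact: cvg_harmonic.
  have cN : continuous N by apply: (nonexpansive_continuous eN) => x h; have := sN.1 x h; lra.
  have w1 : (fun k => (w_ k).1) @ \oo --> w.
    by apply: (cvg_comp _ _ ww); exact: cvg_fst.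
  have w2 : (fun k => (w_ k).2) @ \oo --> r.
    by apply: (cvg_comp _ _ ww); exact: cvg_snd.
  have N1 : (fun k => N (w_ k).1) @ \oo --> N w by apply: continuous_cvg; [exact: cN|exact: w1].
  have tN : (fun k => t_ k * N (w_ k).1) @ \oo --> 0.
    by rewrite -(mul0r (N w)); apply: cvgM => //; exact: cvg_harmonic.
  have rN : (fun k => (w_ k).2 + N (w_ k).1) @ \oo --> r + N w.
    by apply: cvgD; [exact: w2|exact: N1].
  apply: (@closed_cvg _ _ _ _ _ [set x : R | 0 <= x] _ _ _ rN); first exact: closed_ge.
  have /cvgrPdist_le/(_ rad rad0) := tN; apply: filterS => k; rewrite sub0r normrN.
  have Nw := seminorm_ge0 (w_ k).1 sN.
  rewrite ger0_norm; last by rewrite mulr_ge0// ltW.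
  have Nt : N (z + t_ k *: (w_ k).1 - z) = t_ k * N (w_ k).1.
    by rewrite addrAC subrr add0r sN.2 gtr0_norm.
  move=> tN1; have := wA k; rewrite /epigraph/=.
  have [Du|Du] := pselect (D (z + t_ k *: (w_ k).1)); last by rewrite f_out.
  rewrite f_dom// lee_fin => h1.
  have := zmin _ Du; rewrite Nt => /(_ tN1) h2.
  have : 0 <= t_ k * ((w_ k).2 + N (w_ k).1).
    by rewrite mulrDr; move: h1 h2; rewrite -[t_ k *: (w_ k).2]/(t_ k * (w_ k).2); lra.
  by rewrite pmulr_rge0.
exists a => //; split; first by rewrite f_dom.
rewrite f_dom//= => -[w r] /aT.
by rewrite /= mulN1r subr_le0.
Qed.

End subdifferential_realization.

(** * Passing the finite tests through an isometric embedding *)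

Section fuzzy_transfer.
Context {R : realType} {E Z : normedModType R} (j : E -> Z).
Hypotheses (lj : linear j) (jn : forall x, `|j x| = `|x|).

Lemma linear_isometryB x y : j (x - y) = j x - j y.
Proof. by rewrite -scaleN1r addrC lj scaleN1r addrC. Qed.

Lemma equivalent_norm_isometry N : equivalent_norm N -> equivalent_norm (N \o j).
Proof.
have jD x y : j (x + y) = j x + j y by rewrite -{1}[x]scale1r lj scale1r.
have j0 : j 0 = 0 by rewrite -(subrr 0) linear_isometryB subrr.
move=> [sN [c c0 cN] [K K0 NK]]; split.
- split=> [x y|t x] /=; first by rewrite jD sN.1.
  by rewrite -[t *: x]addr0 lj j0 addr0 sN.2.
- by exists c => // x /=; rewrite -jn cN.
- by exists K => // x /=; rewrite -jn NK.
Qed.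

(** The tests speak of points and not of functionals, so lists are pulled back by a section of [j]
    and nothing has to be extended. *)
Lemma fuzzy_isometry N g (D A : set Z) rad z delta :
  A `<=` D -> A `<=` range j ->
  fuzzy (N \o j) (g \o j) (j @^-1` D) rad z delta -> fuzzy N g A rad (j z) delta.
Proof.
move=> AD Aj fz s sP.
have [k kP] : exists k : Z -> E, forall u, A u -> j (k u) = u.
  have /choice[k kP] u : exists x, A u -> j x = u.
    have [Au|nAu] := pselect (A u); last by exists 0.
    by have [x _ jx] := Aj _ Au; exists x.
  by exists k.
have := fz [seq (q.1, k q.2) | q <- s].
have -> : slopes (g \o j) [seq (q.1, k q.2) | q <- s] z ((g \o j) z) = slopes g s (j z) (g (j z)).
  rewrite /slopes big_map !big_seq; apply: eq_bigr => q /sP[Aq _ _] /=.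
  by rewrite kP// -jn linear_isometryB kP.
have -> : (N \o j) (steps [seq (q.1, k q.2) | q <- s] z) = N (steps s (j z)).
  congr N; rewrite /steps big_map; elim: s sP => [|q s IH] sP.
    by rewrite !big_nil -(subrr 0) linear_isometryB subrr.
  rewrite !big_cons -[k q.2 - z]scale1r lj scale1r linear_isometryB kP.
    by rewrite IH// => q' q's; apply: sP; rewrite inE q's orbT.
  by have [] := sP q (mem_head _ _).
apply => _ /mapP[q qs ->] /=; have [Aq qd qz] := sP _ qs.
by split => //; [rewrite /preimage/= kP//; exact: AD|rewrite -jn linear_isometryB kP].
Qed.

End fuzzy_transfer.

(** For unit vectors [x] and [y] chosen independently, [(x, gamma^-1 *: y)] has weighted norm at
    most [1]; taking suprema over [x] and over [y] one after the other adds the two dual norms. *)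
Lemma dual_bound_split {R : realType} (X Y : normedModType R) (gamma s : R)
    (a : dual (X * Y)%type) : 0 < gamma -> 0 <= s ->
  (forall w, a w <= s * weighted_max gamma w) ->
  exists f g, a = dual_pair f g /\ dist_gamma gamma (0, 0) (f, g) <= s.
Proof.
move=> gamma0 s0 aw.
have lX : linear (fun x : X => (x, 0 : Y)).
  by move=> t x x'; rewrite -[RHS]/(t *: x + x', t *: 0 + 0) scaler0 addr0.
have lY : linear (fun y : Y => (0 : X, y)).
  by move=> t y y'; rewrite -[RHS]/(t *: 0 + 0, t *: y + y') scaler0 addr0.
have [f fP] : exists f : dual X, forall x, f x = a (x, 0).
  by apply: (dual_pullback a lX) => x; rewrite prod_normE/= normr0 ge_max lexx/=.
have [g gP] : exists g : dual Y, forall y, g y = a (0, y).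
  by apply: (dual_pullback a lY) => y; rewrite prod_normE/= normr0 ge_max lexx andbT.
have aE x y : a (x, y) = f x + g y.
  have -> : (x, y) = (x, 0) + (0, y) by rewrite -[RHS]/(x + 0, 0 + y) addr0 add0r.
  by rewrite linearD fP gP.
exists f, g; split; first by apply/val_inj/funext => -[x y] /=; exact: aE.
rewrite /dist_gamma/= !sub0r !normrN.
have le_s x y : `|x| <= 1 -> `|y| <= 1 -> f x + gamma^-1 * g y <= s.
  move=> x1 y1; have := aw (x, gamma^-1 *: y).
  rewrite aE linearZ => /le_trans; apply.
  rewrite ler_piMr// /weighted_max/= ge_max x1/= normrZ ger0_norm ?invr_ge0 ?(ltW gamma0)//.
  by rewrite mulVKf ?gt_eqF.
have fs y : `|y| <= 1 -> `|f| <= s - gamma^-1 * g y.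
  move=> y1; apply: dual_norm_le => x x1.
  have := le_s x y x1 y1; have := le_s (- x) y; rewrite normrN linearN => /(_ x1 y1) h1 h2.
  by rewrite ler_norml; apply/andP; split; lra.
have : `|g| <= gamma * (s - `|f|).
  apply: dual_norm_le => y y1; rewrite -ler_pdivrMl//.
  have := fs y y1; have := fs (- y); rewrite normrN linearN => /(_ y1) h1 h2.
  have -> : gamma^-1 * `|g y| = `|gamma^-1 * g y|.
    by rewrite normrM gtr0_norm ?invr_gt0.
  by rewrite ler_norml; apply/andP; split; lra.
by rewrite -ler_pdivrMl// lerBrDl.
Qed.

Lemma edist_normE {R : realType} (V : normedModType R) (x y : V) :
  edist (x, y) = `|x - y|%:E.
Proof.
apply/eqP; rewrite eq_le; apply/andP; split.
  apply/lee_addgt0Pr => e e0; rewrite -EFinD; apply: edist_fin.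
    by rewrite ltr_wpDl.
  by rewrite -ball_normE/= ltrDl.
apply: le_ereal_inf_tmp => _ [r [r0 xy] <-].
by rewrite lee_fin ltW//; move: xy; rewrite -ball_normE.
Qed.

(** * From small subgradients to subregularity *)

Section subregularity_criterion.
Context {R : realType} {X Y : normedModType R}.
Variables (G : X -> set Y) (xbar : X) (ybar : Y) (alpha gamma : R) (delta mu : \bar R).
Variable subdiff : (X * Y -> \bar R) -> X * Y -> set (dual (X * Y)%type).
Hypotheses (alpha0 : 0 < alpha) (gamma0 : 0 < gamma).

(** The interface between the two cases: the argument below is common to the Clarke and the Frechet
    subdifferential. *)
Hypothesis small_subgradient : forall z0 sigma lambda rho, gph G z0 ->
  0 < sigma -> 0 < lambda -> 0 < rho -> `|z0.2 - ybar| < sigma * lambda ->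
  exists z a, [/\ gph G z, weighted_max gamma (z - z0) < lambda,
    `|z.2 - ybar| < `|z0.2 - ybar| + rho, subdiff (psi G ybar) z a &
    forall w, a w <= sigma * weighted_max gamma w].

Lemma subregularity_criterion :
  (forall x y, eball xbar (delta + mu)%E x -> ~ invmap G ybar x ->
    G x y -> eball ybar (alpha%:E * mu)%E y ->
    (alpha%:E <= dist_gamma_set gamma (0, 0)%R (subdiff (psi G ybar) (x, y)))%E) ->
  forall x, eball xbar delta x -> (edist_inf (G x) ybar < alpha%:E * mu)%E ->
    (alpha%:E * edist_inf (invmap G ybar) x <= edist_inf (G x) ybar)%E.
Proof.
move=> large x0 x0d x0mu; rewrite leNgt; apply/negP => x0E.
pose e := edist_inf (G x0) ybar; pose E := edist_inf (invmap G ybar) x0.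
have e_ge0 : (0 <= e)%E by exact: edist_inf_ge0.
have [r er] : exists r : R, e = r%:E.
  move: e_ge0 x0mu; rewrite -/e; case: e => [r _ _|_|]//; first by exists r.
  by rewrite ltNge leey.
have r0 : 0 <= r by rewrite -lee_fin -er.
(* [r < alpha * lambda] allows a suitable [y0], [lambda < mu] keeps the new point in both balls of
   the hypothesis, and [lambda < E] keeps its first component out of [invmap G ybar]. *)
have [lambda [rlambda lmu lE]] : exists lambda : R,
    [/\ r < alpha * lambda, (lambda%:E < mu)%E & (lambda%:E < E)%E].
  have rm : ((r / alpha)%:E < Order.min mu E)%E.
    rewrite lt_min; apply/andP; split.
      by rewrite mulrC EFinM lte_pdivrMl// -er.
    by rewrite mulrC EFinM lte_pdivrMl// -er.
  have [l rl lm] : exists2 l : R, r / alpha < l & (l%:E < Order.min mu E)%E.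
    move: rm; case: (Order.min mu E) => [m|_|]//.
    - rewrite lte_fin => rm; exists ((r / alpha + m) / 2); first by lra.
      by rewrite lte_fin; lra.
    - by exists (r / alpha + 1); [rewrite ltrDl|rewrite ltry].
  exists l; split.
  - by rewrite mulrC -ltr_pdivrMr.
  - by apply: lt_le_trans lm _; rewrite ge_min lexx.
  - by apply: lt_le_trans lm _; rewrite ge_min lexx orbT.
have lambda0 : 0 < lambda by rewrite -(pmulr_rgt0 _ alpha0) (le_lt_trans r0).
have [y0 Gy0 y0l] : exists2 y0, G x0 y0 & `|y0 - ybar| < alpha * lambda.
  have : (edist_inf (G x0) ybar < (alpha * lambda)%:E)%E by rewrite -/e er lte_fin.
  move=> /ereal_inf_lt[_ [y Gy <-]]; rewrite edist_normE lte_fin distrC.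
  by exists y.
(* Strictly below [alpha], so that a subgradient of size at most [sigma] is a contradiction, yet
   steep enough for [|y0 - ybar| < sigma * lambda]. *)
pose sigma := (`|y0 - ybar| / lambda + alpha) / 2.
have y0a : `|y0 - ybar| / lambda < alpha by rewrite ltr_pdivrMr.
have sigma0 : 0 < sigma by rewrite divr_gt0// ltr_wpDl// divr_ge0// ltW.
have sigmaa : sigma < alpha by rewrite /sigma; move: y0a; lra.
have y0s : `|y0 - ybar| < sigma * lambda by rewrite -ltr_pdivrMr// /sigma; move: y0a; lra.
(* This [rho] bounds the new residual by [alpha * lambda], hence by [alpha * mu]. *)
have rho0 : 0 < alpha * lambda - `|y0 - ybar| by rewrite subr_gt0.
have [[x y] [a [Gz zz0 gz az aN]]] :=
  @small_subgradient (x0, y0) sigma lambda _ Gy0 sigma0 lambda0 rho0 y0s.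
rewrite subrKC /= in gz.
have xx0 : `|x - x0| < lambda by apply: le_lt_trans zz0; rewrite /weighted_max/= le_max lexx.
have [f [g [afg fg]]] := dual_bound_split gamma0 (ltW sigma0) aN.
have : (alpha%:E <= dist_gamma_set gamma (0, 0)%R (subdiff (psi G ybar) (x, y)))%E.
  apply: large => //.
  - rewrite /eball/=; apply: (@le_lt_trans _ _ (`|x0 - xbar|%:E + `|x - x0|%:E)%E).
      by rewrite -EFinD lee_fin [leRHS]addrC -[x - xbar](subrKA x0) ler_normD.
    have xmu : (`|x - x0|%:E < mu)%E by apply: lt_trans lmu; rewrite lte_fin.
    by apply: lteD.
  - move=> Gx; have : (E <= `|x0 - x|%:E)%E.
      by rewrite -edist_normE; apply: ereal_inf_lbound; exists x.
    by rewrite distrC leNgt (lt_trans _ lE)// lte_fin.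
  - rewrite /eball/=; apply: (@lt_trans _ _ (alpha * lambda)%:E); first by rewrite lte_fin.
    by rewrite EFinM lte_pmul2l// lte_fin.
rewrite leNgt => /negP; apply.
apply: (@le_lt_trans _ _ sigma%:E); last by rewrite lte_fin.
apply: ge_ereal_inf; exists (dist_gamma gamma (0, 0) (f, g))%:E; last by rewrite lee_fin.
by exists (f, g) => //=; rewrite -afg.
Qed.

End subregularity_criterion.

Section small_subgradients.
Context {R : realType} {X Y : completeNormedModType R}.
Variables (G : X -> set Y) (ybar : Y) (gamma : R).
Hypotheses (cG : closed (gph G)) (gamma0 : 0 < gamma).
Variables (z0 : X * Y) (sigma lambda rho : R).
Hypotheses (Gz0 : gph G z0) (sigma0 : 0 < sigma) (lambda0 : 0 < lambda) (rho0 : 0 < rho).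
Hypothesis z0s : `|z0.2 - ybar| < sigma * lambda.

Let g (w : X * Y) : R := `|w.2 - ybar|.

Let cg : continuous g.
Proof.
move=> w; apply: (@cvg_norm _ _ _ _ _ (fun w : X * Y => w.2 - ybar)).
by apply: cvgB; [exact: cvg_snd|exact: cvg_cst].
Qed.

Let g_ge0 u : gph G u -> 0 <= g u. Proof. by move=> _; exact: normr_ge0. Qed.

Let eN : equivalent_norm (weighted_max gamma : X * Y -> R).
Proof. exact: weighted_max_equivalent. Qed.

Let cXY : @seq_complete R (X * Y)%type.
Proof. by apply: prod_seq_complete; exact: complete_seq_complete. Qed.

Lemma small_clarke_subgradient : exists z a,
  [/\ gph G z, weighted_max gamma (z - z0) < lambda,
    `|z.2 - ybar| < `|z0.2 - ybar| + rho, clarke_subdiff (psi G ybar) z a &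
    forall w, a w <= sigma * weighted_max gamma w].
Proof.
have [z [Gz zz0 gz zmin]] :=
  local_ekeland eN cXY cG cg g_ge0 Gz0 sigma0 lambda0 rho0 z0s.
(* For the rescaled norm the ball [N <= 1] of the Ekeland estimate has radius [sigma]. *)
have [|a aP aN] := clarke_subdiff_of_minimum (equivalent_normZ sigma0 eN) Gz sigma0 (g := g).
  by move=> u Gu; rewrite ger_pMr// => /(zmin u Gu).
by exists z, a.
Qed.

Lemma small_frechet_subgradient : asplund X -> asplund Y -> exists z a,
  [/\ gph G z, weighted_max gamma (z - z0) < lambda,
    `|z.2 - ybar| < `|z0.2 - ybar| + rho, frechet_subdiff (psi G ybar) z a &
    forall w, a w <= sigma * weighted_max gamma w].
Proof.
move=> aX aY; have eN' := equivalent_normZ sigma0 eN.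
pose op (k : rat + bool) (w : X * Y) : X * Y := match k with
  | inl q => ratr q *: w
  | inr b => if b then (w.1, 0) else (0, w.2)
  end.
have [C [cC Cz0 CD Cop red]] := separable_reduction g (gph G) op eN' z0.
have [E [j [lj jn jC /separable_seq[d dP]]]] : exists (E : normedModType R) (j : E -> X * Y),
    [/\ linear j, forall x, `|j x| = `|x|, range j = closure C & separable (dual E)].
  apply: (asplund_hull aX aY cC Cz0 CD) => [q|w|w]; first exact: (Cop (inl q)).
    exact: (Cop (inr true)).
  exact: (Cop (inr false)).
have jB x y : `|j x - j y| = `|x - y| by rewrite -(linear_isometryB lj) jn.
have cj : continuous j by exact: isometry_continuous jB.
have [z0' _ jz0] : range j z0 by rewrite jC; exact: subset_closure.
have cE : @seq_complete R E.
  by apply: (isometry_seq_complete jB) cXY; rewrite jC; exact: closed_closure.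
have eNE := equivalent_norm_isometry lj jn eN.
have cGj : closed (j @^-1` gph G) by apply: closed_comp => // x _; exact: cj.
have cgj : continuous (g \o j) by move=> x; apply: continuous_comp; [exact: cj|exact: cg].
have Gz0' : (j @^-1` gph G) z0' by rewrite /preimage/= jz0.
have gz0' : (g \o j) z0' < sigma * lambda by rewrite /= jz0.
have gj0 u : (j @^-1` gph G) u -> 0 <= (g \o j) u by move=> _; exact: normr_ge0.
have [z [b [Gz zz0 gz bN bP]]] :=
  smooth_variational eNE cE cGj cgj gj0 Gz0' sigma0 lambda0 rho0 gz0' dP.
have eNE' := equivalent_normZ sigma0 eNE.
have [del fz] := fuzzy_of_dual (let: And3 s _ _ := eNE' in s) bN bP.
(* From [E] the tests move to the points of [gph G] in [C], and [red] extends them to all of [gph G]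
   at the smaller radius [4^-1]. *)
have fz' : fuzzy (fun w => sigma * weighted_max gamma w) g (gph G) 4^-1 (j z) del.
  apply: red; first by rewrite -jC; exists z.
  apply: (fuzzy_isometry lj jn (D := gph G)) fz; first by move=> w [].
  by move=> w [_ Cw]; rewrite jC; exact: subset_closure.
have [a aN aP] := dual_of_fuzzy eN' fz'.
exists (j z), a; split => //.
- by rewrite -jz0 -(linear_isometryB lj).
- by move: gz; rewrite /= jz0.
- apply: (frechet_subdiff_of_estimate (g := g) (D := gph G)) aP => // n.
Qed.

End small_subgradients.

Theorem proposition4p1 (R : realType) (P : Type) (X Y : completeNormedModType R)
    (F : P -> X -> set Y) (xbar : X) (ybar : Y) (alpha : R) (delta mu : \bar R)
    (P_nonempty : inhabited P)
    (F_closed : forall p : P, closed (gph (F p)))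
    (alpha_gt0 : 0 < alpha) (delta_gt0 : (0 < delta)%E) (mu_gt0 : (0 < mu)%E) :
  ((exists2 gamma : R, 0 < gamma &
      forall (p : P) (x : X) (y : Y),
        eball xbar (delta + mu)%E x -> ~ invmap (F p) ybar x ->
        F p x y -> eball ybar (alpha%:E * mu)%E y ->
        (alpha%:E <= dist_gamma_set gamma (0, 0)%R
                       (clarke_subdiff (psi (F p) ybar) (x, y)))%E) ->
    subregular F xbar ybar alpha delta mu)
  /\
  (asplund X -> asplund Y ->
    (exists2 gamma : R, 0 < gamma &
      forall (p : P) (x : X) (y : Y),
        eball xbar (delta + mu)%E x -> ~ invmap (F p) ybar x ->
        F p x y -> eball ybar (alpha%:E * mu)%E y ->
        (alpha%:E <= dist_gamma_set gamma (0, 0)%R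
                       (frechet_subdiff (psi (F p) ybar) (x, y)))%E) ->
    subregular F xbar ybar alpha delta mu).
Proof.
split=> [[gamma gamma0 large] p|aX aY [gamma gamma0 large] p].
- apply: (subregularity_criterion (subdiff := @clarke_subdiff R (X * Y)%type)) (large p) => //.
  by move=> *; exact: small_clarke_subgradient.
- apply: (subregularity_criterion (subdiff := @frechet_subdiff R (X * Y)%type)) (large p) => //.
  by move=> *; exact: small_frechet_subgradient.
Qed.
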